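(* Let $A,X$ be disjoint finite sets, $X=Z\uplus Y\uplus B$, and let $\mathcal{V}^1_{AX},\mathcal{V}^2_X$ be vector spaces over a field $\mathbb{F}$ on $A\uplus X$, $X$ respectively. Let $\mathcal{V}^1_{AB}=\mathcal{V}^1_{AX}\circ(A\uplus(X-Z))\times(A\uplus B)$. Let $\mathcal{V}^2_X=\mathcal{F}_Z\oplus\mathbf{0}_Y\oplus\mathcal{V}^2_B$ for a vector space $\mathcal{V}^2_B$ on $B$, and let $\mathcal{V}^1_{AX}\times Z=\mathbf{0}_Z$ and $\mathcal{V}^1_{AX}\circ Y=\mathcal{F}_Y$. Then: 1. (a) $\{\mathcal{V}^1_{AX},\mathcal{V}^2_X\}$ is rigid iff $\{\mathcal{V}^1_{AB},\mathcal{V}^2_B\}$ is rigid. (b) $\{\mathcal{M}(\mathcal{V}^1_{AX}),\mathcal{M}(\mathcal{V}^2_X)\}$ is rigid iff $\{\mathcal{M}(\mathcal{V}^1_{AB}),\mathcal{M}(\mathcal{V}^2_B)\}$ is rigid. (c) $\mathcal{V}^1_{AX}\leftrightarrow\mathcal{V}^2_X=\mathcal{V}^1_{AB}\leftrightarrow\mathcal{V}^2_B$. (d) $\mathcal{M}(\mathcal{V}^1_{AX})\leftrightarrow\mathcal{M}(\mathcal{V}^2_X)=\mathcal{M}(\mathcal{V}^1_{AB})\leftrightarrow\mathcal{M}(\mathcal{V}^2_B)$. 2. Let $\mathcal{M}(\mathcal{V}^1_{AB}+\mathcal{V}^2_B)=\mathcal{M}(\mathcal{V}^1_{AB})\vee\mathcal{M}(\mathcal{V}^2_B)$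 and $\mathcal{M}((\mathcal{V}^1_{AB})^{\perp}+(\mathcal{V}^2_B)^{\perp})=\mathcal{M}((\mathcal{V}^1_{AB})^{\perp})\vee\mathcal{M}((\mathcal{V}^2_B)^{\perp})$. Then: (a) $\mathcal{M}(\mathcal{V}^1_{AX}\leftrightarrow\mathcal{V}^2_X)=\mathcal{M}(\mathcal{V}^1_{AX})\leftrightarrow\mathcal{M}(\mathcal{V}^2_X)=\mathcal{M}(\mathcal{V}^1_{AB})\leftrightarrow\mathcal{M}(\mathcal{V}^2_B)=\mathcal{M}(\mathcal{V}^1_{AB}\leftrightarrow\mathcal{V}^2_B)$. (b) $\{\mathcal{V}^1_{AX},\mathcal{V}^2_X\}$ is rigid iff $\{\mathcal{M}(\mathcal{V}^1_{AX}),\mathcal{M}(\mathcal{V}^2_X)\}$ is rigid. (c) $\{\mathcal{V}^1_{AB},\mathcal{V}^2_B\}$ (respectively $\{\mathcal{V}^1_{AX},\mathcal{V}^2_X\}$) is rigid iff there exists a pair of disjoint bases $b^1,b^2$ of $\mathcal{M}(\mathcal{V}^1_{AB}),\mathcal{M}(\mathcal{V}^2_B)$ (respectively of $\mathcal{M}(\mathcal{V}^1_{AX}),\mathcal{M}(\mathcal{V}^2_X)$) such that $b^1\cup b^2\supseteq B$ (respectively $b^1\cup b^2\supseteq X$). For such a pair $b^1,b^2$, $b^1\cap A$ is a column base of $\mathcal{V}^1_{AX}\leftrightarrow\mathcal{V}^2_X$.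
   Context: Vector spaces. A vector on a finite set $X$ over $\mathbb{F}$ is a function $X\to\mathbb{F}$; a space on $X\uplus Y$ carries the subscript $XY$. $\mathcal{F}_X$ is the space of all vectors on $X$, $\mathbf{0}_X$ the zero space; $\mathcal{V}_X\oplus\mathcal{V}_Y=\{(f_X,g_Y)\}$; $\mathcal{V}_X^{\perp}=\{g_X:\sum_ef(e)g(e)=0\ \forall f_X\in\mathcal{V}_X\}$. For pairwise disjoint $S,P$: $\mathcal{V}_{SP}\circ S=\{f_S:(f_S,f_P)\in\mathcal{V}_{SP}\text{ for some }f_P\}$; $\mathcal{V}_{SP}\times S=\{f_S:(f_S,0_P)\in\mathcal{V}_{SP}\}$ (operations applied left to right); $\mathcal{V}_{SP}+\mathcal{V}_P=\mathcal{V}_{SP}+(\mathbf{0}_S\oplus\mathcal{V}_P)$; $\mathcal{V}_{SP}\leftrightarrow\mathcal{V}_P=\{f_S:(f_S,h_P)\in\mathcal{V}_{SP}\text{ for some }h_P\in\mathcal{V}_P\}$. A column base of $\mathcal{V}_X$ is a maximal linearly independent set of columns of a matrix whose rows form a basis of $\mathcal{V}_X$. A pair $\{\mathcal{V}_{SP},\mathcal{V}_P\}$ is rigid iff $\mathcal{V}_{SP}\circ P+\mathcal{V}_P=\mathcal{F}_P$ and $(\mathcal{V}_{SP}\times P)\cap\mathcal{V}_P=\mathbf{0}_P$. Matroids. $\mathcal{M}(\mathcal{V}_X)$ is the matroid on $X$ whose bases are the column bases of $\mathcal{V}_X$. $\mathcal{F}_X$ (also) denotes the matroid on $X$ with unique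 base $X$, $\mathbf{0}_X$ the one with unique base $\emptyset$. $\mathcal{M}\circ T$ is restriction to $T$, $\mathcal{M}\times T=(\mathcal{M}^*\circ T)^*$ contraction to $T$. For matroids on the same set, $\mathcal{M}_1\vee\mathcal{M}_2$ (union) has as bases the maximal sets $b_1\cup b_2$ and $\mathcal{M}_1\wedge\mathcal{M}_2$ the minimal sets $b_1\cap b_2$, $b_i$ a base of $\mathcal{M}_i$. $\mathcal{M}_{SP}\vee\mathcal{M}_P=\mathcal{M}_{SP}\vee(\mathcal{M}_P\oplus\mathbf{0}_S)$, and $\mathcal{M}_{SP}\leftrightarrow\mathcal{M}_P=(\mathcal{M}_{SP}\vee\mathcal{M}_P)\times S$. A pair $\{\mathcal{M}_{SP},\mathcal{M}_P\}$ is rigid iff $\mathcal{M}_{SP}\circ P\vee\mathcal{M}_P=\mathcal{F}_P$ and $(\mathcal{M}_{SP}\times P)\wedge\mathcal{M}_P=\mathbf{0}_P$. *)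

(* Defs.v *)
From HB Require Import structures.
From mathcomp Require Import all_boot all_order all_algebra.

Set Implicit Arguments.
Unset Strict Implicit.
Unset Printing Implicit Defensive.

Import GRing.Theory.
Local Open Scope ring_scope.

(* All finite sets are subsets of one ambient finite type T.  A vector on      *)
(* X : {set T} is represented by its extension by zero to T, so a space on X   *)
(* is a subspace V of vec F T with (V <= Fsp F X)%VS.  Under this convention   *)
(*   - the pair (f_S, g_P), for disjoint S and P, is f + g;                    *)
(*   - the zero space on any set is 0%VS;                                      *)
(*   - both V_S (+) V_P and V_SP + V_P are the sum of subspaces (V + W)%VS.    *)
(* Operations which depend on the set X take it as an argument.                *)
Notation vec F T := {ffun T -> F^o}.

Definition rst_fun (F : fieldType) (T : finType) (S : {set T}) (f : vec F T) :
    vec F T :=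
  [ffun e => if e \in S then f e else 0].

Lemma rst_fun_is_linear (F : fieldType) (T : finType) (S : {set T}) :
  linear (@rst_fun F T S).
Proof.
move=> a f g; apply/ffunP=> e; rewrite !ffunE.
by case: ifP => // _; rewrite scaler0 addr0.
Qed.

HB.instance Definition _ (F : fieldType) (T : finType) (S : {set T}) :=
  GRing.isLinear.Build F (vec F T) (vec F T) *:%R (@rst_fun F T S)
    (@rst_fun_is_linear F T S).

Definition rst (F : fieldType) (T : finType) (S : {set T}) : 'End(vec F T) :=
  linfun (@rst_fun F T S).

Definition dot (F : fieldType) (T : finType) (f g : vec F T) : F^o :=
  \sum_e (f e * g e : F).

Lemma dot_is_linear (F : fieldType) (T : finType) (f : vec F T) :
  linear (dot f).
Proof.
move=> a g h; rewrite /dot scaler_sumr -big_split; apply: eq_bigr => e _.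
by rewrite !ffunE mulrDr; congr (_ + _); rewrite /GRing.scale /= mulrCA.
Qed.

HB.instance Definition _ (F : fieldType) (T : finType) (f : vec F T) :=
  GRing.isLinear.Build F (vec F T) F^o *:%R (dot f) (dot_is_linear f).

Definition Fsp (F : fieldType) (T : finType) (X : {set T}) :
    {vspace vec F T} :=
  lker (rst F (~: X)).

Definition restr (F : fieldType) (T : finType) (V : {vspace vec F T})
    (S : {set T}) : {vspace vec F T} :=
  (rst F S @: V)%VS.

Definition contr (F : fieldType) (T : finType) (V : {vspace vec F T})
    (S : {set T}) : {vspace vec F T} :=
  (V :&: Fsp F S)%VS.

(* The orthogonal complement inside the space of all vectors on X; see         *)
(* [memv_perp].                                                                *)
Definition perp (F : fieldType) (T : finType) (X : {set T})
    (V : {vspace vec F T}) : {vspace vec F T} :=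
  (Fsp F X :&: \bigcap_(i < \dim V) lker (linfun (dot (vbasis V)`_i)))%VS.

(* V_SP <-> W_P: the vectors f_S with (f_S, h_P) in V for some h_P in W; see   *)
(* [memv_link].                                                                *)
Definition link (F : fieldType) (T : finType) (S P : {set T})
    (V W : {vspace vec F T}) : {vspace vec F T} :=
  restr (V :&: (rst F P @^-1: W))%VS S.

Definition rigid (F : fieldType) (T : finType) (P : {set T})
    (V W : {vspace vec F T}) : Prop :=
  (restr V P + W)%VS = Fsp F P /\ (contr V P :&: W)%VS = 0%VS.

Lemma memv_Fsp (F : fieldType) (T : finType) (X : {set T}) (f : vec F T) :
  reflect (forall e, e \notin X -> f e = 0) (f \in Fsp F X).
Proof.
rewrite memv_ker lfunE /=; apply: (iffP eqP) => [/ffunP f0 e eX | f0].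
  by have := f0 e; rewrite !ffunE inE eX.
by apply/ffunP=> e; rewrite !ffunE inE; case: ifP => // /f0.
Qed.

Lemma memv_restr (F : fieldType) (T : finType) (V : {vspace vec F T})
    (S : {set T}) (f : vec F T) :
  reflect (f \in Fsp F S /\ exists2 g, g \in V & {in S, f =1 g})
          (f \in restr V S).
Proof.
apply: (iffP memv_imgP) => [[g gV ->] | [/memv_Fsp f0 [g gV fg]]].
  split; last by exists g => // e eS; rewrite lfunE ffunE eS.
  by apply/memv_Fsp => e /negPf eS; rewrite lfunE ffunE eS.
exists g => //; apply/ffunP=> e; rewrite lfunE ffunE.
by case: ifPn => [/fg | /f0].
Qed.

Lemma memv_contr (F : fieldType) (T : finType) (V : {vspace vec F T})
    (S : {set T}) (f : vec F T) :
  (f \in contr V S) = (f \in V) && (f \in Fsp F S).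
Proof. exact: memv_cap. Qed.

Lemma memv_perp (F : fieldType) (T : finType) (X : {set T})
    (V : {vspace vec F T}) (g : vec F T) :
  reflect (g \in Fsp F X /\ forall f, f \in V -> \sum_e (f e * g e : F) = 0)
          (g \in perp X V).
Proof.
rewrite memv_cap; apply: (iffP andP) => -[gX g0]; split=> //.
  move=> f /coord_vbasis ->.
  under eq_bigr => e _ do rewrite sum_ffunE mulr_suml.
  rewrite exchange_big big1 // => i _ /=.
  under eq_bigr => e _ do rewrite ffunE -[_ *: _]/(_ * _) -mulrA.
  rewrite -mulr_sumr.
  have /subv_bigcapP/(_ i isT): (<[g]> <= \bigcap_(i < \dim V)
    lker (linfun (dot (vbasis V)`_i)))%VS by [].
  by rewrite -memvE memv_ker lfunE => /eqP; rewrite /= /dot => ->; rewrite mulr0.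
rewrite memvE; apply/subv_bigcapP => i _; rewrite -memvE memv_ker lfunE.
by apply/eqP/g0/vbasis_mem/mem_nth; rewrite size_tuple.
Qed.

Lemma memv_link (F : fieldType) (T : finType) (S P : {set T})
    (V W : {vspace vec F T}) (f : vec F T) :
  [disjoint S & P] -> (V <= Fsp F (S :|: P))%VS -> (W <= Fsp F P)%VS ->
  reflect (f \in Fsp F S /\ exists2 h, h \in W & f + h \in V)
          (f \in link S P V W).
Proof.
move=> dSP /subvP sV /subvP sW; apply: (iffP (memv_restr _ _ _)).
  case=> fS [g /memv_capP[gV]]; rewrite -memv_preim => gW fg; split=> //.
  exists (rst F P g) => //; rewrite (_ : _ + _ = g) //.
  apply/ffunP=> e; rewrite lfunE !ffunE.
  have [eS | eS] := boolP (e \in S).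
    by rewrite (disjointFr dSP eS) addr0 fg.
  rewrite (memv_Fsp _ _ fS) // add0r; case: ifPn => // eP.
  by rewrite (memv_Fsp _ _ (sV _ gV)) // inE negb_or eS.
case=> fS [h hW fhV]; split=> //; exists (f + h).
  rewrite memv_cap fhV -memv_preim (_ : rst F P _ = h) //.
  apply/ffunP=> e; rewrite lfunE !ffunE; case: ifPn => eP.
    by rewrite (memv_Fsp _ _ fS) ?add0r // (disjointFl dSP eP).
  by rewrite (memv_Fsp _ _ (sW _ hW)).
move=> e eS; rewrite ffunE (memv_Fsp _ _ (sW _ hW)) ?addr0 //.
by rewrite (disjointFr dSP eS).
Qed.

(* The column indexed by e of the matrix with rows r_0, ..., r_(n-1).          *)
Definition column (F : fieldType) (T : finType) (n : nat)
    (r : n.-tuple (vec F T)) (e : T) : 'cV[F]_n :=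
  \col_(i < n) (r`_i e : F).

Definition free_columns (F : fieldType) (T : finType) (n : nat)
    (r : n.-tuple (vec F T)) (b : {set T}) : bool :=
  free [seq column r e | e <- enum b].

Definition max_free_columns (F : fieldType) (T : finType) (n : nat)
    (r : n.-tuple (vec F T)) (X b : {set T}) : bool :=
  maxset (fun c : {set T} => (c \subset X) && free_columns r c) b.

(* The choice of the basis of V is immaterial: see [column_baseE].             *)
Definition column_base (F : fieldType) (T : finType) (X : {set T})
    (V : {vspace vec F T}) (b : {set T}) : bool :=
  max_free_columns (vbasis V) X b.

Lemma free_columnsP (F : fieldType) (T : finType) (n : nat)
    (r : n.-tuple (vec F T)) (V : {vspace vec F T}) (b : {set T}) :
  basis_of V r ->
  reflect (forall k : vec F T, k \in Fsp F b ->
             (forall f, f \in V -> dot f k = 0) -> k = 0)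
          (free_columns r b).
Proof.
move=> rV; pose t := [tuple column r (enum_val i) | i < #|b|].
have tE : [seq column r e | e <- enum b] = t.
  apply: (@eq_from_nth _ 0) => [|i].
    by rewrite size_map -cardE size_tuple.
  rewrite size_map -cardE => ib; pose j := Ordinal ib.
  rewrite -[i]/(val j) -(tnth_nth 0 t j) tnth_mktuple (enum_val_nth (enum_val j)).
  by rewrite (nth_map (enum_val j)) // -cardE.
have colE (k : vec F T) i : k \in Fsp F b ->
    (\sum_(j < #|b|) k (enum_val j) *: t`_j) i 0 = dot r`_i k.
  move=> /memv_Fsp k0; rewrite /dot (bigID (mem b)) /= [X in _ + X]big1 ?addr0.
    rewrite summxE [RHS]big_enum_val; apply: eq_bigr => j _.
    by rewrite -(tnth_nth 0 t j) tnth_mktuple !mxE mulrC.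
  by move=> e /k0 ->; rewrite mulr0.
have memr (i : 'I_n) : r`_i \in V.
  by apply: (basis_mem rV); rewrite mem_nth ?size_tuple.
rewrite /free_columns tE; apply: (iffP freeP) => [ft k kb kV | ft k kt i].
  have k0 (j : 'I_#|b|) : k (enum_val j) = 0 :> F.
    apply: (ft (fun i => k (enum_val i)) _ j); apply/matrixP=> i {}j.
    rewrite ord1 colE // mxE; exact/kV.
  apply/ffunP=> e; rewrite ffunE; have [eb | /(memv_Fsp _ _ kb)//] := boolP (e \in b).
  by rewrite -(enum_rankK_in eb eb) k0.
pose h : vec F T := [ffun e => \sum_(j < #|b| | enum_val j == e) k j].
have hE j : h (enum_val j) = k j.
  by rewrite ffunE (eq_bigl (pred1 j)) ?big_pred1_eq // => j'; rewrite (inj_eq enum_val_inj).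
have hb : h \in Fsp F b.
  apply/memv_Fsp => e eb; rewrite ffunE big_pred0 // => j.
  by apply: contraNF eb => /eqP <-; apply: enum_valP.
suff h0 : h = 0 by rewrite -hE h0 ffunE.
apply: ft => // f /(coord_basis rV) ->; rewrite /dot.
under eq_bigr => e _ do rewrite sum_ffunE mulr_suml.
rewrite exchange_big big1 // => j _ /=.
under eq_bigr => e _ do rewrite ffunE -[_ *: _]/(_ * _) -mulrA.
rewrite -mulr_sumr -[\sum_(e in T) _]/(dot _ _) -colE //.
under eq_bigr => l _ do rewrite hE.
by rewrite kt mxE mulr0.
Qed.

Lemma column_baseE (F : fieldType) (T : finType) (X : {set T})
    (V : {vspace vec F T}) (n : nat) (r : n.-tuple (vec F T)) :
  basis_of V r -> column_base X V =1 max_free_columns r X.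
Proof.
move=> rV b; apply: maxset_eq => c; congr (_ && _).
by apply/(free_columnsP c (vbasisP V))/(free_columnsP c rV).
Qed.

(* A matroid is given by its ground set and its family of bases.  The          *)
(* operations below are defined by their effect on bases; the axioms of        *)
(* matroids are the separate predicate [is_matroid], which the matroid of a    *)
(* vector space satisfies by [vmatP].                                          *)
Record matroid (T : finType) := Matroid {
  ground : {set T};
  bases : {set {set T}}
}.

Definition is_matroid (T : finType) (M : matroid T) : Prop :=
  [/\ bases M != set0,
      forall b, b \in bases M -> b \subset ground M
    & forall b1 b2 x, b1 \in bases M -> b2 \in bases M -> x \in b1 :\: b2 ->
        exists2 y, y \in b2 :\: b1 & y |: (b1 :\ x) \in bases M].

Definition vmat (F : fieldType) (T : finType) (X : {set T})
    (V : {vspace vec F T}) : matroid T :=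
  Matroid X [set b | column_base X V b].

Definition mfull (T : finType) (X : {set T}) : matroid T := Matroid X [set X].

Definition mzero (T : finType) (X : {set T}) : matroid T :=
  Matroid X [set set0].

Definition maximals (T : finType) (Q : {set {set T}}) : {set {set T}} :=
  [set b | maxset (fun c => c \in Q) b].

Definition minimals (T : finType) (Q : {set {set T}}) : {set {set T}} :=
  [set b | minset (fun c => c \in Q) b].

Definition mdual (T : finType) (M : matroid T) : matroid T :=
  Matroid (ground M) [set ground M :\: b | b in bases M].

Definition mrestr (T : finType) (M : matroid T) (S : {set T}) : matroid T :=
  Matroid S (maximals [set b :&: S | b in bases M]).

Definition mcontr (T : finType) (M : matroid T) (S : {set T}) : matroid T :=
  mdual (mrestr (mdual M) S).

(* Direct sum; the ground sets are meant to be disjoint. *)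
Definition mdsum (T : finType) (M N : matroid T) : matroid T :=
  Matroid (ground M :|: ground N)
          [set b1 :|: b2 | b1 in bases M, b2 in bases N].

(* For [munion] and [mmeet] the ground sets are meant to be equal. *)
Definition munion (T : finType) (M N : matroid T) : matroid T :=
  Matroid (ground M) (maximals [set b1 :|: b2 | b1 in bases M, b2 in bases N]).

Definition mmeet (T : finType) (M N : matroid T) : matroid T :=
  Matroid (ground M) (minimals [set b1 :&: b2 | b1 in bases M, b2 in bases N]).

(* M_SP \/ N_P, where N_P is extended to S :|: P by loops. *)
Definition munion_ext (T : finType) (S : {set T}) (M N : matroid T) :
    matroid T :=
  munion M (mdsum N (mzero S)).

Definition mlink (T : finType) (S : {set T}) (M N : matroid T) : matroid T :=
  mcontr (munion_ext S M N) S.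

Definition mrigid (T : finType) (P : {set T}) (M N : matroid T) : Prop :=
  munion (mrestr M P) N = mfull P /\ mmeet (mcontr M P) N = mzero P.

Definition disjoint_covering_bases (T : finType) (P : {set T})
    (M N : matroid T) (b1 b2 : {set T}) : Prop :=
  [/\ b1 \in bases M, b2 \in bases N, [disjoint b1 & b2] & P \subset b1 :|: b2].

Lemma vmatP (F : fieldType) (T : finType) (X : {set T})
    (V : {vspace vec F T}) : is_matroid (vmat X V).
Proof.
pose c := column (vbasis V); pose cs (b : {set T}) := [seq c e | e <- enum b].
have freeU (b : {set T}) y : y \notin b ->
    free (cs (y |: b)) = (c y \notin <<cs b>>%VS) && free (cs b).
  move=> yb; rewrite -free_cons; apply/perm_free/(@perm_map _ _ c _ (y :: enum b)).
  apply: uniq_perm; rewrite /= ?enum_uniq ?mem_enum ?yb // => e.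
  by rewrite inE !mem_enum !inE.
have spanX (b : {set T}) : column_base X V b ->
    {in X, forall e, c e \in <<cs b>>%VS}.
  case/maxsetP=> /andP[bX fb] maxb e eX.
  have [eb | eb] := boolP (e \in b); first by rewrite memv_span ?map_f ?mem_enum.
  apply: contraNT eb => ce; rewrite -(maxb (e |: b)) ?setU11 ?subsetU1 //.
  rewrite subUset sub1set eX bX /free_columns -/c -/(cs _) freeU ?ce //.
  apply: contraNN ce => eb; by rewrite memv_span ?map_f ?mem_enum.
split=> [|b|b1 b2 x].
- have P0 : (set0 \subset X) && free_columns (vbasis V) set0.
    by rewrite sub0set /free_columns enum_set0 nil_free.
  have [b bP _] := @maxset_exists T (fun b => (b \subset X) &&
    free_columns (vbasis V) b) set0 P0.
  by apply/set0Pn; exists b; rewrite inE.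
- by rewrite inE => /maxsetp/andP[].
rewrite !inE => b1P b2P /andP[xb2 xb1].
have [/andP[b1X fb1] /andP[b2X fb2]] := (maxsetp b1P, maxsetp b2P).
have xX : x \in X := subsetP b1X x xb1.
have xD : x \notin b1 :\ x by rewrite !inE eqxx.
move: (fb1); rewrite /free_columns -/c -/(cs _) -[in cs b1](setD1K xb1) freeU //.
case/andP=> cx fD.
have [y yb2 cy] : exists2 y, y \in b2 & c y \notin <<cs (b1 :\ x)>>%VS.
  apply/exists_inP; apply: contraNT cx => /exists_inPn cb2.
  apply: subvP (spanX b2 b2P x xX); apply/span_subvP => _ /mapP[y yb2 ->].
  by have := cb2 y; rewrite negbK -(mem_enum b2); apply.
have yD : y \notin b1 :\ x.
  by apply: contraNN cy => yD; rewrite memv_span ?map_f ?mem_enum.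
have yb1 : y \notin b1.
  apply: contraNN yD => yb1; rewrite !inE yb1 andbT.
  by apply: contraNneq xb2 => <-.
exists y; rewrite !inE ?yb1 //.
apply/maxsetP; split=> [|d /andP[dX fd] sub].
  rewrite subUset sub1set (subsetP b2X) // (subset_trans (subD1set _ _) b1X).
  by rewrite /free_columns -/c -/(cs _) freeU // cy.
apply/esym/eqP; rewrite eqEcard sub cardsU1 yD /=.
have -> : (1 + #|b1 :\ x| = #|b1|)%N by rewrite [RHS](cardsD1 x) xb1.
have szE (b : {set T}) : free_columns (vbasis V) b -> #|b| = \dim <<cs b>>.
  by rewrite /free_columns => /eqP ->; rewrite size_map -cardE.
rewrite (szE d fd) (szE b1 fb1) dimvS //.
apply/span_subvP => _ /mapP[e ed ->]; apply: spanX => //.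
by apply: (subsetP dX); rewrite -mem_enum.
Qed.

(* Main.v *)
Require Import Defs.
From mathcomp Require Import all_boot all_order all_algebra.

Set Implicit Arguments.
Unset Strict Implicit.
Unset Printing Implicit Defensive.

(** Two descriptions carry the argument.  A set [b] is a column base of a space
    [V] on [X] iff every vector on [b] is the restriction of a vector of [V],
    and only the zero vector of [V] vanishes on [b] ([column_baseP]).  A pair of
    matroids is rigid iff some two bases together cover [P] and some two,
    possibly others, are disjoint ([mrigidP]).

    Reduction from [X] to [B].  Since [Z] is coindependent and [Y] independent in
    the matroid of V1AX, a set [b] inside A + B is a base of the matroid of V1AB
    iff [b] together with [Y] is a base of the matroid of V1AX
    ([minor_column_base]); the bases of the matroid of V2X are the sets [Z] plus
    a base of V2B.  The claims about matroids follow from these two facts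
    alone: basis exchange moves a base of the large matroid off [Z], or makes it
    contain [Y], while keeping control of its trace on [A] and [B].  For
    the linking operation one must also know that a union of bases which has at
    least the size of a maximal one is itself maximal, i.e. the matroid union
    theorem ([card_maximal_unions]).  The claims about spaces are the same
    manipulations carried out on vectors.

    Spaces against matroids.  Linking [V] with [W] is contracting [V + W] to [A]
    ([link_contr]), contraction commutes with passing to the matroid
    ([vmat_contr]), and by assumption the matroid of [V + W] is the union of the
    two matroids; so linking commutes with passing to the matroid.  Likewise
    {V, W} is rigid iff [B] is independent in the matroid of [V + W] and
    [V :&: W = 0].  The first says that two bases cover [B]; the second says
    that [dim (V + W) = dim V + dim W], that is, that a base b1 + b2 of the
    union has b1 and b2 disjoint.  When both hold, one pair of bases does both,
    whence the criterion by disjoint covering bases. *)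

(** * Pointwise reasoning on sets *)

Lemma in_sub (T : finType) (a b : {set T}) x :
  a \subset b -> (x \in a) ==> (x \in b).
Proof. by move/subsetP => ab; apply/implyP/ab. Qed.

Lemma in_disj (T : finType) (a b : {set T}) x :
  [disjoint a & b] -> ~~ ((x \in a) && (x \in b)).
Proof. by move=> ab; apply/negP=> /andP[/(disjointFr ab)->]. Qed.

(** Set identities and inclusions under such pointwise facts about [x] reduce
    to propositional tautologies in the memberships of [x]. *)
Ltac bool_cases x :=
  rewrite ?inE; repeat match goal with |- context[x \in ?S] => case: (x \in S) end.

Lemma parts_disjoint (T : finType) (A X Z Y B : {set T}) :
  [disjoint A & X] -> [disjoint Z & Y] -> [disjoint Z & B] ->
  [disjoint Y & B] -> X = Z :|: Y :|: B ->
  forall x, [&& ~~ ((x \in A) && (x \in Z)), ~~ ((x \in A) && (x \in Y)),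
    ~~ ((x \in A) && (x \in B)), ~~ ((x \in Z) && (x \in Y)),
    ~~ ((x \in Z) && (x \in B)) & ~~ ((x \in Y) && (x \in B))].
Proof.
move=> dAX dZY dZB dYB defX x.
move: (in_disj x dAX) (in_disj x dZY) (in_disj x dZB) (in_disj x dYB).
by rewrite defX; bool_cases x.
Qed.

(** * Unions of matroids *)

Section Matroids.
Variable T : finType.
Implicit Types (M N : matroid T) (Q : {set {set T}}) (b c d I J S : {set T}).

(** Exchanging the elements of a base above [I] which lie outside [S] against
    elements of a base inside [S] never removes an element of [I]. *)
Lemma base_between M b1 b2 I S : is_matroid M ->
  b1 \in bases M -> b2 \in bases M -> I \subset b1 -> b2 \subset S ->
  I \subset S -> exists b, [/\ b \in bases M, I \subset b & b \subset S].
Proof.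
case=> _ _ exch b1M b2M Ib1 b2S IS.
have [b /andP[bM Ib] minb] := arg_minnP (fun b => #|b :\: S|)
  (introT andP (conj b1M Ib1) : (fun b => (b \in bases M) && (I \subset b)) b1).
exists b; split=> //; apply/subsetP => x xb; apply/negPn/negP => xS.
have xb2 : x \notin b2 by apply: contraNN xS; apply: subsetP.
have [|y] := exch b b2 x bM b2M; first by rewrite inE xb2.
rewrite inE => /andP[yb yb2] yM.
have /minb : (y |: b :\ x \in bases M) && (I \subset y |: b :\ x).
  rewrite yM; apply/subsetP => z zI; rewrite !inE (subsetP Ib) // andbT.
  by rewrite (_ : z != x) ?orbT //; apply: contraNneq xS => <-; apply: subsetP zI.
rewrite leqNgt => /negP; apply; apply: proper_card; apply/properP; split.
  apply/subsetP => z; rewrite !inE => /andP[zS /predU1P[zy|/andP[_ ->]]].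
    by rewrite zy (subsetP b2S) in zS.
  by rewrite zS.
exists x; rewrite !inE ?xS ?eqxx //=; apply: contraNN xS => /orP[/eqP->|//].
exact: subsetP yb2.
Qed.

Lemma card_bases M b1 b2 : is_matroid M ->
  b1 \in bases M -> b2 \in bases M -> #|b1| = #|b2|.
Proof.
case=> _ _ exch; have [n] := ubnP #|b1 :\: b2|.
elim: n b1 => // n IH b1 ltn b1M b2M.
have [/eqP|[x xb]] := set_0Vmem (b1 :\: b2).
  rewrite setD_eq0 => b12; congr #|pred_of_set _|; apply/eqP.
  rewrite eqEsubset b12; apply/subsetP => x xb2; apply/negPn/negP => xb1.
  have [|y] := exch b2 b1 x b2M b1M; first by rewrite inE xb1.
  by rewrite inE => /andP[/negP yb2] /(subsetP b12).
have [y yb yM] := exch b1 b2 x b1M b2M xb.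
move: xb yb; rewrite !inE => /andP[xb2 xb1] /andP[yb1 yb2].
rewrite -(IH (y |: b1 :\ x)) //.
  by rewrite cardsU1 !inE (negPf yb1) andbF (cardsD1 x b1) xb1.
rewrite -ltnS; apply: leq_trans ltn; rewrite ltnS; apply: proper_card; apply/properP; split.
  apply/subsetP => z; rewrite !inE => /andP[zb2 /predU1P[zy|/andP[_ ->]]].
    by rewrite zy yb2 in zb2.
  by rewrite zb2.
exists x; rewrite !inE ?xb2 // eqxx /= orbF.
by apply: contraNneq yb1 => <-.
Qed.

Definition indep M I := [exists b in bases M, I \subset b].

Lemma indepP M I : reflect (exists2 b, b \in bases M & I \subset b) (indep M I).
Proof. exact: exists_inP. Qed.

Lemma indepS M I J : I \subset J -> indep M J -> indep M I.
Proof.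
by move=> IJ /indepP[b bM Jb]; apply/indepP; exists b => //; apply: subset_trans Jb.
Qed.

Lemma indep_augment M I J : is_matroid M -> indep M I -> indep M J ->
  #|I| < #|J| -> exists2 e, e \in J :\: I & indep M (e |: I).
Proof.
move=> mM /indepP[b1 b1M Ib1] /indepP[b2 b2M Jb2] ltIJ.
have [b [bM Ib bS]] := base_between mM b1M b2M Ib1 (subsetUr I b2) (subsetUl I b2).
have [dJb | [e]] := set_0Vmem ((J :\: I) :&: b); last first.
  rewrite inE => /andP[eJI eb]; exists e => //; apply/indepP; exists b => //.
  by rewrite subUset sub1set eb.
have sub : b \subset I :|: (b2 :\: J).
  apply/subsetP => x xb; have := subsetP bS x xb; rewrite !inE.
  case: (boolP (x \in I)) => //= xI ->; rewrite andbT; apply/negP => xJ.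
  have : x \in (J :\: I) :&: b by rewrite !inE xI xJ xb.
  by rewrite dJb inE.
have := leq_trans (subset_leq_card sub) (leq_card_setU _ _).
rewrite (card_bases mM bM b2M) -(cardsID J b2) (setIidPr Jb2).
by rewrite leq_add2r leqNgt ltIJ.
Qed.

Lemma maximals_exists Q c : c \in Q -> exists2 d, d \in maximals Q & c \subset d.
Proof.
by move=> cQ; have [d dQ cd] := maxset_exists cQ; exists d => //; rewrite inE.
Qed.

Lemma maximalsP Q c :
  reflect (c \in Q /\ forall d, d \in Q -> c \subset d -> d = c)
          (c \in maximals Q).
Proof. by rewrite inE; apply: maxsetP. Qed.

Lemma minimals_exists Q c : c \in Q -> exists2 d, d \in minimals Q & d \subset c.
Proof.
by move=> cQ; have [d dQ cd] := minset_exists cQ; exists d => //; rewrite inE.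
Qed.

Lemma minimalsP Q c :
  reflect (c \in Q /\ forall d, d \in Q -> d \subset c -> d = c)
          (c \in minimals Q).
Proof. by rewrite inE; apply: minsetP. Qed.

Definition unions M N := [set b1 :|: b2 | b1 in bases M, b2 in bases N].

(** The matroid union theorem.  Write c and d as disjoint unions I1 + I2 and
    J1 + J2 of independent sets, with I1 and I2 chosen to overlap J1 and J2 as
    much as possible.  If d were larger, J1 (say) would be larger than I1 and
    supply an e augmenting I1.  An e outside c contradicts the maximality of c,
    and an e in I2 could be moved from I2 to I1, increasing the overlap. *)
Lemma card_maximal_unions M N c d : is_matroid M -> is_matroid N ->
  c \in maximals (unions M N) -> d \in unions M N -> #|d| <= #|c|.
Proof.
move=> mM mN /maximalsP[/imset2P[b1 b2 b1M b2N defc] maxc] /imset2P[d1 d2 d1M d2N defd].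
rewrite leqNgt; apply/negP => ltcd.
pose J1 := d1; pose J2 := d2 :\: d1.
(* J2 omits J1, so that moving an element of J1 out of I2 costs no overlap. *)
pose P (p : {set T} * {set T}) := [&& indep M p.1, indep N p.2,
  p.1 :|: p.2 == c & [disjoint p.1 & p.2]].
have P0 : P (b1, b2 :\: b1).
  rewrite /P /=; apply/and4P; split.
  - by apply/indepP; exists b1.
  - by apply/indepP; exists b2; rewrite // subsetDl.
  - by rewrite defc; apply/eqP/setP=> x; rewrite !inE; case: (x \in b1).
  - by rewrite -setI_eq0; apply/eqP/setP=> x; rewrite !inE; case: (x \in b1).
have [[I1 I2] /= /and4P[/= iI1 iI2 /eqP UI dI] maxI] :=
  arg_maxnP (fun p : {set T} * {set T} => #|p.1 :&: J1| + #|p.2 :&: J2|) P0.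
have full I1' I2' e : e \in d -> e \notin c -> indep M I1' -> indep N I2' ->
    c \subset I1' :|: I2' -> e \in I1' :|: I2' -> False.
  move=> ed ec /indepP[a1 a1M Ia1] /indepP[a2 a2N Ia2] sub eI.
  have sa : I1' :|: I2' \subset a1 :|: a2 by apply: setUSS.
  have := maxc (a1 :|: a2) (imset2_f _ a1M a2N) (subset_trans sub sa).
  by move=> ac; rewrite -ac (subsetP sa) in ec.
have cI : #|c| = #|I1| + #|I2| by rewrite -UI cardsU disjoint_setI0 // cards0 subn0.
have cJ : #|d| = #|J1| + #|J2|.
  rewrite defd cardsU -(cardsID d1 d2) setIC /J2.
  by rewrite addnC -addnA addKn addnC.
have iJ1 : indep M J1 by apply/indepP; exists d1.
have iJ2 : indep N J2 by apply/indepP; exists d2; rewrite // subsetDl.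
have [lt1 | le1] := ltnP #|I1| #|J1|.
  have [e] := indep_augment mM iI1 iJ1 lt1; rewrite inE => /andP[eI1 eJ1] iI1'.
  have ed : e \in d by rewrite defd inE eJ1.
  have [ec | ec] := boolP (e \in c); last first.
    apply: (full _ _ e ed ec iI1' iI2); first by rewrite -UI setSU // subsetUr.
    by rewrite !inE eqxx.
  have eI2 : e \in I2 by move: ec; rewrite -UI inE (negPf eI1).
  have /maxI /= : P (e |: I1, I2 :\ e).
    rewrite /P /= iI1' (indepS _ iI2) ?subD1set //=; apply/andP; split.
      rewrite -UI; apply/eqP/setP=> x; rewrite !inE.
      by case: eqP => [->|]; rewrite ?eI2 ?orbT.
    rewrite -setI_eq0; apply/eqP/setP=> x; rewrite !inE.
    case: eqP => //= _; apply/negP => /andP[x1 x2].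
    by rewrite (disjointFr dI x1) in x2.
  have -> : (e |: I1) :&: J1 = e |: (I1 :&: J1).
    by apply/setP=> x; rewrite !inE; case: eqP => // ->; rewrite eJ1.
  have -> : (I2 :\ e) :&: J2 = I2 :&: J2.
    by apply/setP=> x; rewrite !inE; case: eqP => // ->; rewrite eJ1 /= andbF.
  by rewrite cardsU1 inE (negPf eI1) add1n addSn ltnn.
have lt2 : #|I2| < #|J2|.
  by rewrite ltnNge; apply: contraL ltcd => le2; rewrite cI cJ -leqNgt leq_add.
have [e] := indep_augment mN iI2 iJ2 lt2; rewrite inE => /andP[eI2 eJ2] iI2'.
have [ed1 ed2] : e \notin d1 /\ e \in d2.
  by move: eJ2; rewrite inE => /andP[].
have ed : e \in d by rewrite defd inE ed2 orbT.
have [ec | ec] := boolP (e \in c); last first.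
  apply: (full _ _ e ed ec iI1 iI2'); first by rewrite -UI setUS // subsetUr.
  by rewrite !inE eqxx orbT.
have eI1 : e \in I1 by move: ec; rewrite -UI inE (negPf eI2) orbF.
have /maxI /= : P (I1 :\ e, e |: I2).
  rewrite /P /= iI2' (indepS _ iI1) ?subD1set //=; apply/andP; split.
    rewrite -UI; apply/eqP/setP=> x; rewrite !inE.
    by case: eqP => [->|]; rewrite ?eI1 ?orbT.
  rewrite -setI_eq0; apply/eqP/setP=> x; rewrite !inE.
  case: eqP => //= _; apply/negP => /andP[x1 x2].
  by rewrite (disjointFr dI x1) in x2.
have -> : (e |: I2) :&: J2 = e |: (I2 :&: J2).
  by apply/setP=> x; rewrite !inE; case: eqP => // ->; rewrite ed1 ed2.
have -> : (I1 :\ e) :&: J1 = I1 :&: J1.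
  by apply/setP=> x; rewrite !inE; case: eqP => // ->; rewrite /J1 (negPf ed1) !andbF.
by rewrite cardsU1 inE (negPf eI2) add1n addnS ltnn.
Qed.

Lemma maximal_unions_card M N c d : is_matroid M -> is_matroid N ->
  c \in maximals (unions M N) -> d \in unions M N -> #|c| <= #|d| ->
  d \in maximals (unions M N).
Proof.
move=> mM mN cU dU led; apply/maximalsP; split=> // d' d'U dd'.
apply/esym/eqP; rewrite eqEcard dd'.
by apply: leq_trans led; apply: card_maximal_unions cU d'U.
Qed.

Lemma bases_munion_ext S M N : bases (munion_ext S M N) = maximals (unions M N).
Proof.
rewrite /munion_ext /munion /unions /=; congr maximals.
suff -> : [set b1 :|: b2 | b1 in bases N, b2 in [set set0]] = bases N by [].
apply/setP=> b; apply/imset2P/idP => [[b1 _ b1N /set1P-> ->]|bN].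
  by rewrite setU0.
by exists b set0; rewrite ?inE // setU0.
Qed.

(** Complementation in [S] turns the maximal traces on [S] of the bases of the
    dual into the minimal traces of the bases. *)
Lemma bases_mcontr M S : S \subset ground M ->
  bases (mcontr M S) = minimals [set b :&: S | b in bases M].
Proof.
move=> SG; have capD b : (ground M :\: b) :&: S = S :\: (b :&: S).
  apply/setP=> x; rewrite !inE; case: (boolP (x \in S)) => [xS|]; last by rewrite !andbF.
  by rewrite (subsetP SG) // !andbT.
have DD b : S :\: (S :\: (b :&: S)) = b :&: S 
  by apply/setP=> x; rewrite !inE; case: (x \in S); rewrite ?andbF ?andbT ?negbK.
rewrite /mcontr /mdual /mrestr /=; set Q := [set b :&: S | b in _].
have QP d : d \in Q -> exists2 b, b \in bases M & d = S :\: (b :&: S).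
  by case/imsetP => _ /imsetP[b bM ->] ->; exists b.
have PQ b : b \in bases M -> S :\: (b :&: S) \in Q.
  by move=> bM; rewrite -capD; do 2!apply: imset_f.
apply/setP=> d; apply/imsetP/minimalsP => [[c /maximalsP[cQ] + ->]|[]].
  have [b bM ->] := QP c cQ; rewrite DD => maxc; split; first exact: imset_f.
  move=> _ /imsetP[b' b'M ->] sub.
  by rewrite -(DD b') (maxc _ (PQ _ b'M) (setDS S sub)) DD.
case/imsetP=> b bM ->{d} minb; exists (S :\: (b :&: S)); last by rewrite DD.
apply/maximalsP; split=> [|c cQ]; first exact: PQ.
have [b' b'M ->] := QP c cQ; move/(setDS S); rewrite !DD => sub.
by rewrite (minb _ (imset_f (fun b => b :&: S) b'M) sub).
Qed.

End Matroids.

(** * Rigidity and linking in terms of pairs of bases *)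

Section Rigid.
Variable T : finType.
Implicit Types (M N : matroid T) (Q R : {set {set T}}) (A b c d P : {set T}).

Lemma minimals_dominated Q R : Q \subset R ->
  (forall r, r \in R -> exists2 q, q \in Q & q \subset r) ->
  minimals R = minimals Q.
Proof.
move=> /subsetP QR dom; apply/setP=> d.
apply/minimalsP/minimalsP=> -[dR mind]; split; try by move=> c /QR; apply: mind.
- by have [q qQ qd] := dom d dR; rewrite -(mind q) ?QR.
- exact: QR.
move=> r /dom[q qQ qr] rd; apply/eqP; rewrite eqEsubset rd.
by rewrite -(mind q qQ (subset_trans qr rd)).
Qed.

(** A base of the restriction is a trace of a base that is maximal; enlarging
    a trace keeps a cover of [P] a cover. *)
Lemma munion_mrestr_full M N P : (forall b, b \in bases N -> b \subset P) ->
  munion (mrestr M P) N = mfull P <->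
  exists b1 b2, [/\ b1 \in bases M, b2 \in bases N & P \subset b1 :|: b2].
Proof.
move=> sN; set U := [set c1 :|: c2 | c1 in bases (mrestr M P), c2 in bases N].
split=> [[UP] | [b1 [b2 [b1M b2N Pb]]]].
  have /maximalsP[/imset2P[c b2 /maximalsP[/imsetP[b1 b1M ->] _] b2N PE] _] :
    P \in maximals U by rewrite UP inE.
  exists b1, b2; split=> //; have : P \subset b1 :&: P :|: b2 by rewrite -PE.
  by move/subset_trans; apply; rewrite setSU // subsetIl.
have subP u : u \in U -> u \subset P.
  case/imset2P=> c b /maximalsP[/imsetP[b' _ ->] _] bN ->.
  by rewrite subUset subsetIr sN.
have [|c cM sc] := @maximals_exists T [set b :&: P | b in bases M] (b1 :&: P).
  exact: imset_f.
have PU : P \in U.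
  have <- : c :|: b2 = P; last exact: imset2_f.
  apply/eqP; rewrite eqEsubset subP ?imset2_f //; apply/subsetP=> x xP.
  have := subsetP Pb x xP; rewrite !inE => /orP[xb|->]; last by rewrite orbT.
  by rewrite (subsetP sc) // inE xb.
congr Matroid; apply/setP=> u; apply/maximalsP/set1P=> [[uU maxu]|->].
  by rewrite (maxu P) // subP.
by split=> // d /subP dP Pd; apply/eqP; rewrite eqEsubset dP.
Qed.

(** A base of the contraction is a trace of a base that is minimal; shrinking
    a trace keeps it disjoint from a given set. *)
Lemma mmeet_mcontr_zero M N P : P \subset ground M ->
  (forall b, b \in bases N -> b \subset P) ->
  mmeet (mcontr M P) N = mzero P <->
  exists b1 b2, [/\ b1 \in bases M, b2 \in bases N & [disjoint b1 & b2]].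
Proof.
move=> PM sN; rewrite /mmeet (bases_mcontr PM).
set R := minimals [set b :&: P | b in _].
set U := [set c1 :&: c2 | c1 in R, c2 in _].
split=> [[U0] | [b1 [b2 [b1M b2N db]]]].
  have /minimalsP[/imset2P[c b2 /minimalsP[/imsetP[b1 b1M ->] _] b2N PE] _] :
    set0 \in minimals U by rewrite U0 inE.
  exists b1, b2; split=> //; rewrite -setI_eq0; apply/eqP.
  by rewrite -(setIidPr (sN _ b2N)) setIA.
have [|c cM sc] := @minimals_exists T [set b :&: P | b in bases M] (b1 :&: P).
  exact: imset_f.
have U0 : set0 \in U.
  have <- : c :&: b2 = set0; last exact: imset2_f.
  apply/eqP; rewrite setI_eq0; apply: disjointWl db.
  by apply: subset_trans sc (subsetIl _ _).
congr Matroid; apply/setP=> u; apply/minimalsP/set1P=> [[uU minu]|->].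
  by rewrite (minu set0) // sub0set.
by split=> // d _; rewrite subset0 => /eqP.
Qed.

Lemma mrigidP M N P : P \subset ground M ->
  (forall b, b \in bases N -> b \subset P) ->
  mrigid P M N <->
  (exists b1 b2, [/\ b1 \in bases M, b2 \in bases N & P \subset b1 :|: b2]) /\
  (exists b1 b2, [/\ b1 \in bases M, b2 \in bases N & [disjoint b1 & b2]]).
Proof.
move=> PM sN; rewrite /mrigid.
by have [] := munion_mrestr_full M sN; have [] := mmeet_mcontr_zero PM sN; tauto.
Qed.

Lemma mlinkE A M N : A \subset ground M ->
  mlink A M N = Matroid A (minimals [set c :&: A | c in maximals (unions M N)]).
Proof.
move=> AM; congr Matroid.
by rewrite -(bases_munion_ext A) -(@bases_mcontr _ (munion_ext A M N)).
Qed.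

End Rigid.

(** * Deleting a coindependent set and contracting an independent one *)

Section Reduction.
Variables (T : finType) (A B X Y Z : {set T}) (M MB N NX : matroid T).
Hypotheses (dAX : [disjoint A & X]) (dZY : [disjoint Z & Y])
  (dZB : [disjoint Z & B]) (dYB : [disjoint Y & B]) (defX : X = Z :|: Y :|: B).
Hypotheses (mM : is_matroid M) (mNX : is_matroid NX).
Hypotheses (gM : ground M = A :|: X) (gMB : ground MB = A :|: B).
(* [MB] is [M] with [Z] deleted and [Y] contracted; [NX] is [N] with coloops [Z]
   and loops [Y] added. *)
Hypothesis sN : forall b, b \in bases N -> b \subset B.
Hypothesis basesMB : forall b,
  (b \in bases MB) = (b \subset A :|: B) && (b :|: Y \in bases M).
Hypothesis basesNX : forall c,
  c \in bases NX <-> exists2 b, b \in bases N & c = Z :|: b.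
Hypothesis coindepZ : exists2 b, b \in bases M & [disjoint b & Z].
Hypothesis indepY : indep M Y.

Let dis := parts_disjoint dAX dZY dZB dYB defX.

Lemma base_minor b : b \in bases M -> [disjoint b & Z] -> Y \subset b ->
  b :\: Y \in bases MB.
Proof.
move=> bM dbZ Yb; have [_ /(_ _ bM) + _] := mM; rewrite gM defX => sb.
rewrite basesMB (_ : b :\: Y :|: Y = b).
  rewrite bM andbT; apply/subsetP=> x; move: (in_disj x dbZ) (in_sub x sb).
  by bool_cases x.
by apply/setP=> x; move: (in_sub x Yb); bool_cases x.
Qed.

Lemma base_avoiding b1 : b1 \in bases M ->
  exists b, [/\ b \in bases M, b1 :\: Z \subset b & [disjoint b & Z]].
Proof.
move=> b1M; have [b0 b0M dbZ] := coindepZ.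
have [|||b [bM b1b]] := @base_between _ M b1 b0 (b1 :\: Z) (~: Z) mM b1M b0M.
- exact: subsetDl.
- by rewrite -disjoints_subset.
- by rewrite setDE subsetIr.
by rewrite -disjoints_subset; exists b.
Qed.

Lemma base_containing b1 : b1 \in bases M ->
  exists b, [/\ b \in bases M, Y \subset b & b \subset Y :|: b1].
Proof.
move=> b1M; have /indepP[b0 b0M Yb0] := indepY.
exact: base_between b0M b1M Yb0 (subsetUr _ _) (subsetUl _ _).
Qed.

(** The part of b1 outside [Z] extends to a base off [Z]; covering [X] forces
    [Y] into b1, as [NX] cannot cover it. *)
Lemma reduced_covering :
  (exists b1 c, [/\ b1 \in bases M, c \in bases NX & X \subset b1 :|: c]) <->
  (exists b b2, [/\ b \in bases MB, b2 \in bases N & B \subset b :|: b2]).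
Proof.
split=> [[b1 [_ [b1M /basesNX[b2 b2N ->] Xb]]]|[b [b2 [bM b2N Bb]]]].
  have [b [bM b1b dbZ]] := base_avoiding b1M.
  exists (b :\: Y), b2; split=> //; first apply: base_minor => //.
    apply/subsetP=> x; move: (dis x) (in_sub x (sN b2N)) (in_sub x Xb) (in_sub x b1b).
    by rewrite defX; bool_cases x.
  apply/subsetP=> x; move: (dis x) (in_sub x Xb) (in_sub x b1b).
  by rewrite defX; bool_cases x.
exists (b :|: Y), (Z :|: b2); split.
- by move: bM; rewrite basesMB => /andP[].
- by apply/basesNX; exists b2.
by apply/subsetP=> x; move: (in_sub x Bb); rewrite defX; bool_cases x.
Qed.

(** Being disjoint from a base of [NX] forces b1 off [Z]; completing [Y] by
    elements of b1 to a base keeps it disjoint from b2, which avoids [Y]. *)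
Lemma reduced_disjoint :
  (exists b1 c, [/\ b1 \in bases M, c \in bases NX & [disjoint b1 & c]]) <->
  (exists b b2, [/\ b \in bases MB, b2 \in bases N & [disjoint b & b2]]).
Proof.
split=> [[b1 [_ [b1M /basesNX[b2 b2N ->] db]]]|[b [b2 [bM b2N db]]]].
  have [b [bM Yb bb1]] := base_containing b1M.
  exists (b :\: Y), b2; split=> //; first apply: base_minor => //.
    apply/pred0P=> x; apply/negbTE; move: (dis x) (in_sub x bb1) (in_disj x db).
    by rewrite /=; bool_cases x.
  apply/pred0P=> x; apply/negbTE; move: (dis x) (in_sub x bb1) (in_disj x db).
  by rewrite /=; bool_cases x.
move: bM; rewrite basesMB => /andP[bAB bM].
exists (b :|: Y), (Z :|: b2); split=> //; first by apply/basesNX; exists b2.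
apply/pred0P=> x; apply/negbTE.
move: (dis x) (in_sub x bAB) (in_disj x db) (in_sub x (sN b2N)).
by rewrite /=; bool_cases x.
Qed.

Lemma basesNX_sub c : c \in bases NX -> c \subset X.
Proof.
case/basesNX=> b bN ->; apply/subsetP=> x; move: (in_sub x (sN bN)).
by rewrite defX; bool_cases x.
Qed.

Lemma reduced_mrigid : mrigid X M NX <-> mrigid B MB N.
Proof.
have XM : X \subset ground M by rewrite gM subsetUr.
have BM : B \subset ground MB by rewrite gMB subsetUr.
have [rX Xr] := mrigidP XM basesNX_sub; have [rB Br] := mrigidP BM sN.
by have := reduced_covering; have := reduced_disjoint; tauto.
Qed.

Lemma covering_reduce b1 c : disjoint_covering_bases X M NX b1 c ->
  disjoint_covering_bases B MB N (b1 :\: Y) (c :\: Z).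
Proof.
case=> b1M /basesNX[b2 b2N ->] db Xb.
have -> : (Z :|: b2) :\: Z = b2.
  apply/setP=> x; move: (dis x) (in_sub x (sN b2N)); by bool_cases x.
split=> //; first apply: base_minor => //.
- apply/pred0P=> x; apply/negbTE; move: (in_disj x db).
  by rewrite /=; bool_cases x.
- apply/subsetP=> x; move: (dis x) (in_sub x Xb) (in_sub x (sN b2N)).
  by rewrite defX; bool_cases x.
- apply/pred0P=> x; apply/negbTE; move: (in_disj x db).
  by rewrite /=; bool_cases x.
apply/subsetP=> x; move: (dis x) (in_sub x Xb).
by rewrite defX; bool_cases x.
Qed.

Lemma covering_extend b b2 : disjoint_covering_bases B MB N b b2 ->
  disjoint_covering_bases X M NX (b :|: Y) (Z :|: b2).
Proof.
case; rewrite basesMB => /andP[bAB bM] b2N db Bb; split=> //.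
- by apply/basesNX; exists b2.
- apply/pred0P=> x; apply/negbTE.
  move: (dis x) (in_sub x bAB) (in_disj x db) (in_sub x (sN b2N)).
  by rewrite /=; bool_cases x.
by apply/subsetP=> x; move: (in_sub x Bb); rewrite defX; bool_cases x.
Qed.

Lemma unions_extend c : c \in unions MB N -> Y :|: Z :|: c \in unions M NX.
Proof.
case/imset2P=> b b2; rewrite basesMB => /andP[bAB bM] b2N ->.
rewrite (_ : _ :|: _ = (b :|: Y) :|: (Z :|: b2)).
  by apply: imset2_f => //; apply/basesNX; exists b2.
by apply/setP=> x; bool_cases x.
Qed.

(** Moving b1 off [Z] loses nothing, since [Z] is in every base of [NX].
    Exchanging it for a base inside Y + b1 that contains [Y] can only decrease
    its intersection with the base of [NX], hence not the size of the union; by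
    equicardinality the new union is again maximal. *)
Lemma unions_reduce c : c \in maximals (unions M NX) ->
  exists c', [/\ c' \in unions MB N, c' \subset A :|: B, c' \subset c :|: Y
    & Y :|: Z :|: c' \in maximals (unions M NX)].
Proof.
move=> cmax; have /maximalsP[/imset2P[b1 n b1M nN cE] maxc] := cmax.
have /basesNX[b2 b2N nE] := nN.
have [b0 [b0M b10 db0]] := base_avoiding b1M.
(* The new union contains c, so it equals c by maximality. *)
have {}cE : c = b0 :|: n.
  apply/esym/maxc; first exact: imset2_f.
  rewrite cE nE; apply/subsetP=> x; move: (in_sub x b10).
  by bool_cases x.
have [b [bM Yb bb0]] := base_containing b0M.
have dbZ : [disjoint b & Z].
  apply/pred0P=> x; apply/negbTE; move: (dis x) (in_sub x bb0) (in_disj x db0).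
  by rewrite /=; bool_cases x.
have bMB := base_minor bM dbZ Yb.
have bAB : b :\: Y \subset A :|: B by move: bMB; rewrite basesMB => /andP[].
exists (b :\: Y :|: b2); split.
- exact: imset2_f.
- apply/subsetP=> x; move: (in_sub x bAB) (in_sub x (sN b2N)).
  by bool_cases x.
- rewrite cE nE; apply/subsetP=> x; move: (in_sub x bb0); by bool_cases x.
have -> : Y :|: Z :|: (b :\: Y :|: b2) = b :|: n.
  by rewrite nE; apply/setP=> x; move: (in_sub x Yb); bool_cases x.
apply: maximal_unions_card cmax _ _ => //; first exact: imset2_f.
rewrite cE !cardsU (card_bases mM b0M bM) leq_sub2l // subset_leq_card //.
rewrite nE; apply/subsetP=> x.
move: (dis x) (in_sub x bb0) (in_sub x (sN b2N)) (in_disj x dbZ).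
by bool_cases x.
Qed.

(** Adding [Y] and [Z] to a union of the small pair gives one of the large pair
    with the same trace on [A] ([unions_extend]).  By [unions_reduce] this
    preserves maximality, and the trace of any maximal union of the large pair
    contains one obtained in this way. *)
Lemma reduced_mlink : mlink A M NX = mlink A MB N.
Proof.
rewrite !mlinkE ?gM ?gMB ?subsetUl //; congr Matroid.
have subAB c : c \in unions MB N -> c \subset A :|: B.
  case/imset2P=> b b2; rewrite basesMB => /andP[bAB _] b2N ->.
  by rewrite subUset bAB (subset_trans (sN b2N)) // subsetUr.
have down c : c \in unions MB N -> Y :|: Z :|: c \in maximals (unions M NX) ->
    c \in maximals (unions MB N).
  move=> cU /maximalsP[_ maxc]; apply/maximalsP; split=> // d dU cd.
  have /maxc/(_ (setUS _ cd)) := unions_extend dU => /setP e.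
  apply/setP=> x; move: (e x) (dis x) (in_sub x (subAB _ cU)) (in_sub x (subAB _ dU)).
  by bool_cases x.
apply: minimals_dominated.
  apply/subsetP=> _ /imsetP[c cmax ->]; have [cU maxc] := maximalsP _ _ cmax.
  have [d dmax cd] := maximals_exists (unions_extend cU).
  have [d' [d'U d'AB d'd /maximalsP[_ maxd']]] := unions_reduce dmax.
  have dE : d = Y :|: Z :|: d'.
    have /maximalsP[dU _] := dmax; apply: maxd' => //; apply/subsetP=> x.
    by move: (in_sub x cd) (in_sub x d'd); bool_cases x.
  have cd' : d' = c.
    apply: maxc => //; apply/subsetP=> x; move: (dis x) (in_sub x cd).
    by rewrite dE; move: (in_sub x (subAB _ cU)); bool_cases x.
  apply/imsetP; exists d => //; rewrite dE cd'; apply/setP=> x; move: (dis x).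
  by bool_cases x.
move=> _ /imsetP[c cmax ->]; have [c' [c'U c'AB c'c c'max]] := unions_reduce cmax.
exists (c' :&: A); first by apply/imsetP; exists c'; rewrite // down.
apply/subsetP=> x; move: (dis x) (in_sub x c'c).
by bool_cases x.
Qed.

End Reduction.

Import GRing.Theory.
Local Open Scope ring_scope.

(** * Column bases of a space *)

Section ColumnBases.
Variables (F : fieldType) (T : finType).
Implicit Types (V W : {vspace vec F T}) (f g h : vec F T) (S I b : {set T}).

(** Independence and spanning in the matroid of [V], expressed by the vectors of
    [V] rather than by columns of a matrix: see [free_columnsE] and
    [column_baseP]. *)
Definition col_indep V I := restr V I == Fsp F I.

Definition col_spanning V S := contr V (~: S) == 0%VS.

Lemma col_indepP V I :
  reflect (forall g, exists2 f, f \in V & {in I, f =1 g}) (col_indep V I).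
Proof.
apply: (iffP eqP) => [VI g | VI].
  have : rst F I g \in Fsp F I.
    by apply/memv_Fsp => e /negPf eI; rewrite lfunE ffunE eI.
  rewrite -VI => /memv_restr[_ [f fV gf]]; exists f => // e eI.
  by rewrite -gf // lfunE ffunE eI.
apply/vspaceP => g; apply/memv_restr/idP => [[] // | gI]; split=> //.
by have [f fV fg] := VI g; exists f => // e eI; rewrite fg.
Qed.

Lemma contr0P V S :
  reflect (forall f, f \in V -> (forall e, e \notin S -> f e = 0) -> f = 0)
          (contr V S == 0%VS).
Proof.
apply: (iffP eqP) => [V0 f fV f0 | V0].
  by apply/eqP; rewrite -memv0 -V0 memv_contr fV; apply/memv_Fsp.
apply/eqP; rewrite -subv0; apply/subvP => f; rewrite memv_contr => /andP[fV].
by move/memv_Fsp => f0; rewrite (V0 f) ?mem0v.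
Qed.

Lemma col_spanningP V S :
  reflect (forall f, f \in V -> {in S, forall e, f e = 0} -> f = 0)
          (col_spanning V S).
Proof.
apply: (iffP (contr0P _ _)) => V0 f fV f0; apply: V0 => // e.
  by rewrite inE negbK; apply: f0.
by move=> eS; apply: f0; rewrite inE eS.
Qed.

(** A suitable multiple of [f] corrects the value at [e] without changing the
    values on [I]. *)
Lemma col_indepU1 V I f e :
  col_indep V I -> f \in V -> {in I, forall x, f x = 0} -> f e != 0 ->
  col_indep V (e |: I).
Proof.
move=> /col_indepP VI fV f0 fe; apply/col_indepP => g; have [v vV vg] := VI g.
exists (v + (((g e : F) - v e) / f e) *: f).
  by rewrite memvD // memvZ.
move=> x; rewrite !inE !ffunE => /predU1P[->|xI].
  by rewrite /GRing.scale /= divfK // addrC subrK.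
by rewrite (f0 x) // scaler0 addr0 vg.
Qed.

(** A maximal independent set [b] between [I] and [S] is spanning, by
    [col_indepU1] applied to a nonzero vector vanishing on [b]. *)
Lemma exists_col_base V I S :
  col_indep V I -> col_spanning V S -> I \subset S ->
  exists b, [/\ I \subset b, b \subset S, col_indep V b & col_spanning V b].
Proof.
move=> VI /col_spanningP VS IS.
have [|b /maxsetP[/andP[bS Vb] maxb] Ib] :=
  @maxset_exists T (fun b => (b \subset S) && col_indep V b) I.
  by rewrite IS.
exists b; split=> //; apply/col_spanningP => f fV f0.
apply: VS => // e eS; apply/eqP; apply: contraTT (eS) => fe.
have eb : e \notin b by apply: contraNN fe => /f0->.
have := maxb (e |: b); rewrite subsetU1 subUset sub1set bS eS /= => /(_ _ isT) be.
case/negP: eb; rewrite -be ?setU11 //.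
exact: col_indepU1 Vb fV f0 fe.
Qed.

Lemma col_indep_dot V I k :
  col_indep V I -> k \in Fsp F I -> (forall f, f \in V -> dot f k = 0) -> k = 0.
Proof.
move=> /col_indepP VI /memv_Fsp k0 kV; apply/ffunP=> e; rewrite ffunE.
have [eI | /k0 //] := boolP (e \in I).
have [f fV fe] := VI [ffun x => (x == e)%:R].
rewrite -(kV f fV) /dot (bigD1 e) //= fe // ffunE eqxx mul1r big1 ?addr0 // => x xe.
have [xI | /k0 ->] := boolP (x \in I); last by rewrite mulr0.
by rewrite fe // ffunE (negPf xe) mul0r.
Qed.

(** Let [c] be a maximal subset of [I] with [col_indep V c]. If e is in [I] but
    not in [c], the value at e of a vector of [V] is determined by its values on
    [c]; with v_x in [V] dual to x in [c], this linear dependence between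
    coordinates is a nonzero [k] on [I] orthogonal to [V]. *)
Lemma dot_col_indep V I :
  (forall k, k \in Fsp F I -> (forall f, f \in V -> dot f k = 0) -> k = 0) ->
  col_indep V I.
Proof.
move=> Vk; have [|c /maxsetP[/andP[cI Vc] maxc] _] :=
  @maxset_exists T (fun b => (b \subset I) && col_indep V b) set0.
  rewrite sub0set; apply/col_indepP => g; exists 0; rewrite ?mem0v // => e.
  by rewrite inE.
suff -> : I = c by [].
apply/eqP; rewrite eqEsubset cI andbT; apply/subsetP => e eI.
apply/negPn/negP => ec.
have f0 f : f \in V -> {in c, forall x, f x = 0} -> f e = 0.
  move=> fV fc; apply/eqP; apply: contraNT ec => fe.
  rewrite -(maxc (e |: c)) ?setU11 ?subsetU1 //.
  by rewrite subUset sub1set eI cI; apply: col_indepU1 Vc fV fc fe.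
have /fin_all_exists2[v vV vc] : forall x, exists2 f, f \in V &
    {in c, f =1 ([ffun y => (y == x)%:R] : vec F T)}.
  by move=> x; move/col_indepP: Vc; apply.
(* The relation f e = sum_(x in c) f x * v_x e, as a vector orthogonal to V. *)
pose k : vec F T :=
  [ffun x => if x == e then 1 : F else if x \in c then - v x e else 0].
have kI : k \in Fsp F I.
  apply/memv_Fsp => x xI; rewrite ffunE; case: eqP => [xe|_].
    by rewrite xe eI in xI.
  by case: ifP => // /(subsetP cI) xI'; rewrite xI' in xI.
have /ffunP/(_ e) : k = 0.
  apply: Vk => // f fV; rewrite /dot (bigD1 e) //= ffunE eqxx mulr1.
  have sV : f - \sum_(x in c) (f x : F) *: v x \in V.
    by rewrite memvB // memv_suml // => x _; rewrite memvZ.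
  have h : (f - \sum_(x in c) (f x : F) *: v x) e = 0.
    apply: f0 => // y yc; rewrite !ffunE sum_ffunE (bigD1 y) //= big1 ?addr0.
      by rewrite ffunE vc // ffunE eqxx /GRing.scale /= mulr1 subrr.
    move=> x /andP[xc xy]; rewrite ffunE vc // ffunE eq_sym (negPf xy).
    by rewrite scaler0.
  rewrite !ffunE sum_ffunE in h; rewrite -[RHS]h; congr (_ + _).
  rewrite -sumrN (bigID (mem c)) /= [X in _ + X]big1 ?addr0; last first.
    move=> x /andP[xe /negPf xc]; rewrite ffunE (negPf xe) xc.
    exact: mulr0.
  apply: eq_big => [x | x /andP[xe xc]].
    by case: eqP => // ->; rewrite (negPf ec).
  by rewrite !ffunE (negPf xe) xc mulrN.
by rewrite !ffunE eqxx => /eqP; rewrite oner_eq0.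
Qed.

Lemma free_columnsE V b : free_columns (vbasis V) b = col_indep V b.
Proof.
apply/(free_columnsP b (vbasisP V))/idP => [|Vb k]; first exact: dot_col_indep.
exact: col_indep_dot Vb.
Qed.

Lemma column_baseP X V b : (V <= Fsp F X)%VS ->
  reflect [/\ b \subset X, col_indep V b & col_spanning V b] (column_base X V b).
Proof.
move=> /subvP VX; have sX : col_spanning V X.
  apply/col_spanningP => f /VX /memv_Fsp f0 fX; apply/ffunP=> e; rewrite ffunE.
  by have [/fX|/f0] := boolP (e \in X).
apply: (iffP maxsetP) => [[/andP[bX]] | [bX Vb Sb]].
  rewrite free_columnsE => Vb maxb; split=> //.
  have [c [bc cX Vc Sc]] := exists_col_base Vb sX bX.
  by rewrite -(maxb c) // cX free_columnsE.
rewrite bX free_columnsE; split=> // c /andP[cX]; rewrite free_columnsE => Vc bc.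
apply/eqP; rewrite eqEsubset bc andbT; apply/subsetP => e ec; apply/negPn/negP=> eb.
have /col_indepP/(_ [ffun x => (x == e)%:R])[f fV fc] := Vc.
have /ffunP/(_ e) : f = 0.
  move/col_spanningP: Sb; apply=> // x xb; rewrite fc ?(subsetP bc) // ffunE.
  by case: eqP => // xe; rewrite -xe xb in eb.
by rewrite fc // !ffunE eqxx => /eqP; rewrite oner_eq0.
Qed.

Lemma Fsp1 e : Fsp F [set e] = <[([ffun x => (x == e)%:R] : vec F T)]>%VS.
Proof.
apply/vspaceP => f; apply/memv_Fsp/vlineP => [f0 | [a -> x]].
  exists (f e); apply/ffunP=> x; rewrite !ffunE /GRing.scale /=.
  case: eqP => [->|/eqP xe]; first by rewrite mulr1.
  by rewrite mulr0 f0 // inE.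
by rewrite inE !ffunE => /negPf->; rewrite scaler0.
Qed.

Lemma subv_Fsp S I : S \subset I -> (Fsp F S <= Fsp F I)%VS.
Proof.
move=> SI; apply/subvP => f /memv_Fsp f0; apply/memv_Fsp => e eI.
by apply: f0; apply: contraNN eI; apply: subsetP.
Qed.

Lemma Fsp_setU S I : Fsp F (S :|: I) = (Fsp F S + Fsp F I)%VS.
Proof.
apply/eqP; rewrite eqEsubv subv_add !subv_Fsp ?subsetUl ?subsetUr ?andbT //.
apply/subvP => f /memv_Fsp f0; apply/memv_addP; exists (rst F S f).
  by apply/memv_Fsp => e /negPf eS; rewrite lfunE ffunE eS.
exists (f - rst F S f); last by rewrite addrC subrK.
apply/memv_Fsp => e eI; rewrite lfunE !ffunE; case: ifPn => [|eS].
  by rewrite subrr.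
by rewrite subr0 f0 // inE negb_or eS.
Qed.

Lemma Fsp_disjoint S I : [disjoint S & I] -> (Fsp F S :&: Fsp F I = 0)%VS.
Proof.
move=> dSI; apply/eqP; rewrite -subv0; apply/subvP => f /memv_capP[].
move=> /memv_Fsp fS /memv_Fsp fI; rewrite memv0; apply/eqP/ffunP=> e.
rewrite ffunE; have [eS|/fS //] := boolP (e \in S).
by rewrite fI // (disjointFr dSI eS).
Qed.

Lemma Fsp0 : Fsp F (set0 : {set T}) = 0%VS.
Proof.
by rewrite -[LHS]capvv Fsp_disjoint // -setI_eq0 set0I.
Qed.

Lemma dim_Fsp S : \dim (Fsp F S) = #|S|.
Proof.
have [n] := ubnP #|S|; elim: n S => // n IH S ltS; have [->|[e eS]] := set_0Vmem S.
  by rewrite Fsp0 dimv0 cards0.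
rewrite -(setD1K eS) Fsp_setU dimv_disjoint_sum.
  rewrite Fsp1 IH; last by move: ltS; rewrite (cardsD1 e S) eS.
  rewrite dim_vline cardsU1 !inE eqxx.
  suff -> : ([ffun x => (x == e)%:R] : vec F T) != 0 by [].
  apply/eqP => /ffunP/(_ e)/eqP; rewrite !ffunE eqxx; exact/negP/oner_neq0.
by apply: Fsp_disjoint; rewrite disjoints1 !inE eqxx.
Qed.

Lemma lker_rst S : lker (rst F S) = Fsp F (~: S).
Proof. by rewrite /Fsp setCK. Qed.

Lemma dim_contr_restr V S :
  (\dim (contr V (~: S)) + \dim (restr V S) = \dim V)%N.
Proof. by rewrite -(limg_ker_dim (rst F S) V) lker_rst. Qed.

Lemma card_column_base X V b :
  (V <= Fsp F X)%VS -> column_base X V b -> #|b| = \dim V.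
Proof.
move=> VX /(column_baseP _ VX)[_ /eqP Vb /eqP Sb].
by rewrite -(dim_contr_restr V b) Vb Sb dimv0 dim_Fsp.
Qed.

Lemma column_base_card X V b :
  (V <= Fsp F X)%VS ->
  column_base X V b = [&& b \subset X, col_spanning V b & #|b| == \dim V].
Proof.
move=> VX; apply/(column_baseP _ VX)/and3P => [[bX Vb Sb]|[bX Sb cb]].
  split=> //; apply/eqP/(@card_column_base X) => //; exact/column_baseP.
split=> //; rewrite /col_indep eqEdim dim_Fsp (eqP cb) -(dim_contr_restr V b).
rewrite (eqP Sb) dimv0 leqnn andbT.
by apply/subvP => f /memv_restr[].
Qed.
End ColumnBases.

(** * A pair of spaces whose sum has the union matroid *)

Section SumMatroid.
Variables (F : fieldType) (T : finType).
Implicit Types (V W : {vspace vec F T}) (f g h : vec F T) (A B I J P S b : {set T}).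

Lemma col_indepS V I J : I \subset J -> col_indep V J -> col_indep V I.
Proof.
move=> /subsetP IJ /col_indepP VJ; apply/col_indepP => g.
by have [f fV fg] := VJ g; exists f => // e /IJ /fg.
Qed.

Lemma col_indep_subv V W I : (V <= W)%VS -> col_indep V I -> col_indep W I.
Proof.
move=> /subvP VW /col_indepP VI; apply/col_indepP => g.
by have [f /VW fW fg] := VI g; exists f.
Qed.

Lemma col_indep0 V : col_indep V set0.
Proof. by apply/col_indepP=> g; exists 0; rewrite ?mem0v // => e; rewrite inE. Qed.

Lemma rst_Fsp S f : rst F S f \in Fsp F S.
Proof. by apply/memv_Fsp => e /negPf eS; rewrite lfunE ffunE eS. Qed.

Lemma rst_in S f e : e \in S -> rst F S f e = f e.
Proof. by move=> eS; rewrite lfunE ffunE eS. Qed.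

Lemma rst_id S f : f \in Fsp F S -> rst F S f = f.
Proof.
move=> /memv_Fsp f0; apply/ffunP=> e; rewrite lfunE ffunE.
by case: ifPn => // /f0.
Qed.

(** As [W] lives on [P], adding [W] commutes with restriction to [P], and the
    contraction in the second condition is absorbed by [W]. *)
Lemma rigidP P V W : (W <= Fsp F P)%VS ->
  rigid P V W <-> col_indep (V + W) P /\ (V :&: W = 0)%VS.
Proof.
move=> WP; have WE : (rst F P @: W)%VS = W.
  apply/vspaceP => f; apply/memv_imgP/idP => [[g gW ->]|fW].
    by rewrite rst_id // (subvP WP).
  by exists f; rewrite ?rst_id // (subvP WP).
rewrite /rigid /contr -capvA (capv_idPr WP) /col_indep /restr limgD WE.
by split=> -[] => [->|/eqP]; split.
Qed.

Lemma spanning_Fsp X V : (V <= Fsp F X)%VS -> col_spanning V X.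
Proof.
move=> /subvP VX; apply/col_spanningP => f /VX /memv_Fsp f0 fX; apply/ffunP=> e.
by rewrite ffunE; have [/fX|/f0] := boolP (e \in X).
Qed.

Section Contraction.
Variables (A B : {set T}) (V : {vspace vec F T}).
Hypothesis dAB : [disjoint A & B].
Hypothesis sV : (V <= Fsp F (A :|: B))%VS.

Let sVA : (contr V A <= Fsp F A)%VS.
Proof. exact: capvSr. Qed.

Lemma spanning_contr b : col_spanning V b -> col_spanning (contr V A) (b :&: A).
Proof.
move/col_spanningP => Vb; apply/col_spanningP => f; rewrite memv_contr.
move=> /andP[fV /memv_Fsp fA] f0; apply: Vb => // e eb.
by have [eA|/fA //] := boolP (e \in A); apply: f0; rewrite inE eb.
Qed.

(** [d] is independent in [V], and [d :|: B] is spanning since a vector of [V]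
    that vanishes on [B] lies in the contraction. *)
Lemma contr_base_extend d : column_base A (contr V A) d ->
  exists b, [/\ column_base (A :|: B) V b, d \subset b, b \subset d :|: B
    & b :&: A = d].
Proof.
case/(column_baseP _ sVA)=> dA Vd /col_spanningP Sd.
have Vd' : col_indep V d := col_indep_subv (capvSl _ _) Vd.
have [|b [db bd Vb Sb]] := exists_col_base Vd' _ (subsetUl d B).
  apply/col_spanningP => f fV f0; apply: Sd => [|e ed].
    rewrite memv_contr fV; apply/memv_Fsp => e eA.
    have [eB|eB] := boolP (e \in B); first by rewrite f0 // inE eB orbT.
    by apply: (memv_Fsp _ _ (subvP sV _ fV)); rewrite inE negb_or eA.
  by apply: f0; rewrite inE ed.
exists b; split=> //.
  by apply/(column_baseP _ sV); split=> //; apply: subset_trans bd (setSU _ dA).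
apply/setP=> x; move: (in_sub x db) (in_sub x bd) (in_sub x dA) (in_disj x dAB).
by bool_cases x.
Qed.

Lemma contr_base_in b : column_base (A :|: B) V b ->
  exists2 d, column_base A (contr V A) d & d \subset b :&: A.
Proof.
case/(column_baseP _ sV)=> _ _ /spanning_contr Sb.
have [d [_ db Vd Sd]] := exists_col_base (col_indep0 _) Sb (sub0set _).
exists d => //; apply/(column_baseP _ sVA); split=> //.
exact: subset_trans db (subsetIr _ _).
Qed.

(** Every trace [b :&: A] of a base contains a base of [contr V A], and each
    of those is a trace: so they are the minimal traces. *)
Lemma vmat_contr : vmat A (contr V A) = mcontr (vmat (A :|: B) V) A.
Proof.
suff bE : bases (vmat A (contr V A)) = bases (mcontr (vmat (A :|: B) V) A).
  exact: (congr1 (Matroid A) bE).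
rewrite bases_mcontr /= ?subsetUl //; apply/setP=> d; rewrite inE.
apply/idP/minimalsP => [dbase|[/imsetP[b]]].
  have [b [bb _ _ bA]] := contr_base_extend dbase; split.
    by apply/imsetP; exists b; rewrite ?inE.
  move=> _ /imsetP[b2 + ->] sub; rewrite inE => /contr_base_in[d2 d2base d2b].
  apply/eqP; rewrite eqEcard sub (card_column_base sVA dbase).
  by rewrite -(card_column_base sVA d2base) subset_leq_card.
rewrite inE => bbase ->{d} mind; have [d dbase db] := contr_base_in bbase.
rewrite -(mind d _ db) //; have [c [cbase _ _ <-]] := contr_base_extend dbase.
by apply/imsetP; exists c; rewrite ?inE.
Qed.

(** By cardinality [b] is the extension, given by [contr_base_extend], of a
    base of [contr V A] inside [b]. *)
Lemma column_base_contr b : column_base (A :|: B) V b -> B \subset b ->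
  column_base A (contr V A) (b :&: A).
Proof.
move=> bbase Bb; have [d dbase dbA] := contr_base_in bbase.
have [c [cbase dc cd cA]] := contr_base_extend dbase.
suff -> : b = c by rewrite cA.
apply/esym/eqP; rewrite eqEcard (card_column_base sV bbase).
rewrite (card_column_base sV cbase) leqnn andbT.
apply: subset_trans cd _; rewrite subUset Bb andbT.
exact: subset_trans dbA (subsetIl _ _).
Qed.

End Contraction.

Section Sum.
Variables (A B : {set T}) (V W : {vspace vec F T}).
Hypothesis dAB : [disjoint A & B].
Hypothesis sV : (V <= Fsp F (A :|: B))%VS.
Hypothesis sW : (W <= Fsp F B)%VS.
Hypothesis vmatD : vmat (A :|: B) (V + W)%VS =
  munion_ext A (vmat (A :|: B) V) (vmat B W).

Lemma link_contr : link A B V W = contr (V + W)%VS A.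
Proof.
apply/vspaceP => f; rewrite memv_contr; apply/(memv_link _ dAB sV sW)/andP.
  case=> fA [h hW fhV]; split=> //; rewrite -[f](addrK h).
  by rewrite memv_add // memvN.
case=> /memv_addP[v vV [w wW ->]] fA; split=> //; exists (- w); first by rewrite memvN.
by rewrite addrK.
Qed.

Let sVW : (V + W <= Fsp F (A :|: B))%VS.
Proof. by rewrite subv_add sV (subv_trans sW) // subv_Fsp // subsetUr. Qed.

Lemma column_base_sum c : column_base (A :|: B) (V + W)%VS c =
  (c \in maximals (unions (vmat (A :|: B) V) (vmat B W))).
Proof. by rewrite -(bases_munion_ext A) -vmatD inE. Qed.

Lemma card_sum_bases b1 b2 :
  b1 \in bases (vmat (A :|: B) V) -> b2 \in bases (vmat B W) ->
  #|b1| = \dim V /\ #|b2| = \dim W.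
Proof.
rewrite !inE => b1V b2W.
by rewrite (card_column_base sV b1V) (card_column_base sW b2W).
Qed.

Lemma vmat_link : vmat A (link A B V W) = mlink A (vmat (A :|: B) V) (vmat B W).
Proof. by rewrite link_contr (vmat_contr dAB) // /mlink -vmatD. Qed.

(** Extend [B] to a base of [V + W], which is some b1 + b2. Its size is
    [\dim V + \dim W], as [V :&: W = 0], so b1 and b2 are disjoint. *)
Lemma rigid_covering : rigid B V W -> exists b1 b2,
  disjoint_covering_bases B (vmat (A :|: B) V) (vmat B W) b1 b2.
Proof.
case/(rigidP _ sW)=> iB VW0.
have [c [Bc cAB Vc Sc]] := exists_col_base iB (spanning_Fsp sVW) (subsetUr A B).
have cbase : column_base (A :|: B) (V + W)%VS c by apply/column_baseP.
have := cbase; rewrite column_base_sum => /maximalsP[/imset2P[b1 b2 b1M b2N cE] _].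
have [c1 c2] := card_sum_bases b1M b2N.
exists b1, b2; split; rewrite -?cE //.
have := card_column_base sVW cbase; rewrite dimv_disjoint_sum // -c1 -c2 cE.
have := cardsUI b1 b2; rewrite -setI_eq0 -cards_eq0 => + e.
by rewrite e => /eqP; rewrite -[X in _ == X]addn0 eqn_add2l.
Qed.

Lemma covering_mrigid b1 b2 :
  disjoint_covering_bases B (vmat (A :|: B) V) (vmat B W) b1 b2 ->
  mrigid B (vmat (A :|: B) V) (vmat B W).
Proof.
case=> b1M b2N db Bb; apply/mrigidP; rewrite ?subsetUr //.
  by have [_] := vmatP B W.
by split; exists b1, b2.
Qed.

Lemma union_column_base b1 b2 :
  b1 \in bases (vmat (A :|: B) V) -> b2 \in bases (vmat B W) ->
  exists2 c, column_base (A :|: B) (V + W)%VS c & b1 :|: b2 \subset c.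
Proof.
move=> b1M b2N; have [c cmax bc] := maximals_exists (imset2_f (@setU T) b1M b2N).
by exists c; rewrite // column_base_sum.
Qed.

(** The covering pair makes [B] independent in [V + W]; the disjoint pair
    forces [\dim (V + W)] to be at least [\dim V + \dim W]. *)
Lemma mrigid_rigid : mrigid B (vmat (A :|: B) V) (vmat B W) -> rigid B V W.
Proof.
have gB : B \subset ground (vmat (A :|: B) V) by rewrite subsetUr.
have [_ sN _] := vmatP B W.
case/(mrigidP gB sN)=> -[b1 [b2 [b1M b2N Bb]]] [d1 [d2 [d1M d2N dd]]].
apply/(rigidP _ sW); split.
  have [c cbase bc] := union_column_base b1M b2N.
  have /(column_baseP _ sVW)[_ Vc _] := cbase.
  exact: col_indepS (subset_trans Bb bc) Vc.
have [c cbase dc] := union_column_base d1M d2N.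
have [c1 c2] := card_sum_bases d1M d2N.
have := subset_leq_card dc; rewrite (card_column_base sVW cbase) cardsU.
rewrite (disjoint_setI0 dd) cards0 subn0 c1 c2 -dimv_sum_cap.
by rewrite -[X in (_ <= X)%N]addn0 leq_add2l leqn0 dimv_eq0 => /eqP.
Qed.

(** By size b1 + b2 is a base of [V + W]; it contains [B], and its trace on [A]
    is that of b1, since b2 is inside [B]. *)
Lemma covering_link_base b1 b2 :
  disjoint_covering_bases B (vmat (A :|: B) V) (vmat B W) b1 b2 ->
  column_base A (link A B V W) (b1 :&: A).
Proof.
case=> b1M b2N db Bb; have [c cbase bc] := union_column_base b1M b2N.
have [_ /(_ _ b2N) /= b2B _] := vmatP B W.
have cE : b1 :|: b2 = c.
  apply/eqP; rewrite eqEcard bc (card_column_base sVW cbase).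
  have [c1 c2] := card_sum_bases b1M b2N.
  rewrite cardsU (disjoint_setI0 db) cards0 subn0 c1 c2.
  by rewrite -dimv_sum_cap leq_addr.
have -> : b1 :&: A = c :&: A.
  rewrite -cE; apply/setP=> x; move: (in_sub x b2B) (in_disj x dAB).
  by bool_cases x.
by rewrite link_contr (column_base_contr dAB) -?cE // cE.
Qed.

End Sum.
End SumMatroid.

(** * The minor of a space *)

Section Minor.
Variables (F : fieldType) (T : finType) (A X Z Y B : {set T}).
Variables (V1 V2 V1' V2' : {vspace vec F T}).
Implicit Types (f g h : vec F T).
Hypotheses (dAX : [disjoint A & X]) (dZY : [disjoint Z & Y])
  (dZB : [disjoint Z & B]) (dYB : [disjoint Y & B]) (defX : X = Z :|: Y :|: B).
Hypotheses (sV1 : (V1 <= Fsp F (A :|: X))%VS) (sV2 : (V2' <= Fsp F B)%VS).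
Hypothesis defV1' : V1' = contr (restr V1 (A :|: (X :\: Z))) (A :|: B).
Hypothesis defV2 : V2 = (Fsp F Z + V2')%VS.
Hypotheses (V1Z : contr V1 Z = 0%VS) (V1Y : restr V1 Y = Fsp F Y).

Let dis := parts_disjoint dAX dZY dZB dYB defX.

Lemma Fsp_out S f e : f \in Fsp F S -> e \notin S -> f e = 0.
Proof. by move/memv_Fsp; apply. Qed.

(** The component on [Z] may be forgotten when [Z] is deleted, but the one on
    [Y] has to be zero. *)
Lemma memv_minor g :
  reflect (g \in Fsp F (A :|: B) /\ exists2 z, z \in Fsp F Z & g + z \in V1)
          (g \in V1').
Proof.
rewrite defV1' memv_contr.
apply: (iffP andP) => [[/memv_restr[_ [f fV gf]] gAB] | [gAB [z zZ gzV]]].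
  split=> //; exists (rst F Z f); first exact: rst_Fsp.
  suff -> : g + rst F Z f = f by [].
  apply/ffunP=> e; rewrite lfunE !ffunE; move: (dis e).
  have [eZ|eZ] := boolP (e \in Z).
    rewrite (Fsp_out gAB) ?add0r // !inE.
    by move: eZ (dis e); bool_cases e.
  rewrite addr0 => _; have [eAX|eAX] := boolP (e \in A :|: X).
    by rewrite gf //; move: eAX eZ; bool_cases e.
  rewrite (Fsp_out (subvP sV1 _ fV)) // (Fsp_out gAB) //.
  by move: eAX; rewrite defX; bool_cases e.
split=> //; apply/memv_restr; split.
  apply: subvP gAB; apply: subv_Fsp; apply/subsetP=> x; move: (dis x).
  by rewrite defX; bool_cases x.
exists (g + z) => // e eAX; rewrite ffunE (Fsp_out zZ) ?addr0 //.
by move: (dis e) eAX; rewrite defX; bool_cases e.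
Qed.

Lemma minor_sub : (V1' <= Fsp F (A :|: B))%VS.
Proof. by rewrite defV1' capvSr. Qed.

(** Restricting the vectors of [V1] that vanish on [Y] to A + B is injective,
    since its kernel lies in [contr V1 Z], and the image is [V1']. *)
Lemma minor_dim : (\dim V1' + #|Y| = \dim V1)%N.
Proof.
rewrite -(dim_contr_restr V1 Y) V1Y dim_Fsp; congr (_ + _)%N.
rewrite -(dim_contr_restr (contr V1 (~: Y)) (A :|: B)).
have -> : contr (contr V1 (~: Y)) (~: (A :|: B)) = 0%VS.
  apply/eqP; rewrite -subv0 -V1Z; apply/subvP=> f; rewrite !memv_contr.
  case/andP=> /andP[fV fY] fAB; rewrite fV; apply/memv_Fsp => e eZ.
  have [eAX|eAX] := boolP (e \in A :|: X); last exact: Fsp_out (subvP sV1 _ fV) eAX.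
  have [eY|eY] := boolP (e \in Y); first by rewrite (Fsp_out fY) // inE eY.
  by apply: (Fsp_out fAB); move: eAX eZ eY; rewrite defX; bool_cases e.
rewrite dimv0 add0n; congr (\dim _); apply/vspaceP => g.
apply/memv_minor/memv_restr => -[gAB].
  case=> z zZ gzV; split=> //; exists (g + z).
    rewrite memv_contr gzV; apply/memv_Fsp => e; rewrite !inE negbK ffunE => eY.
    rewrite (Fsp_out gAB) ?(Fsp_out zZ) ?addr0 //.
      by move: eY (dis e); bool_cases e.
    by move: eY (dis e); bool_cases e.
  move=> e eAB; rewrite ffunE (Fsp_out zZ) ?addr0 //.
  by move: eAB (dis e); bool_cases e.
case=> f; rewrite memv_contr => /andP[fV fY] gf; split=> //.
exists (rst F Z f); first exact: rst_Fsp.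
suff -> : g + rst F Z f = f by [].
apply/ffunP=> e; rewrite lfunE !ffunE.
have [eAB|eAB] := boolP (e \in A :|: B).
  rewrite gf // ifN ?addr0 //; by move: eAB (dis e); bool_cases e.
rewrite (Fsp_out gAB) // add0r; case: ifPn => // eZ.
have [eY|eY] := boolP (e \in Y); first by rewrite (Fsp_out fY) // inE eY.
rewrite (Fsp_out (subvP sV1 _ fV)) //.
by move: eAB eZ eY; rewrite defX; bool_cases e.
Qed.

(** The sizes match by [minor_dim]; for the spanning part, a vector of [V1]
    which vanishes on [Y] is one of [V1'] plus a vector on [Z], and the latter is
    determined by the former because [contr V1 Z = 0]. *)
Lemma minor_column_base b :
  column_base (A :|: B) V1' b = (b \subset A :|: B) && column_base (A :|: X) V1 (b :|: Y).
Proof.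
rewrite (column_base_card _ minor_sub) (column_base_card _ sV1).
have [bAB /=|//] := boolP (b \subset A :|: B).
have -> : b :|: Y \subset A :|: X.
  by apply/subsetP=> x; move: (in_sub x bAB); rewrite defX; bool_cases x.
have dbY : [disjoint b & Y].
  apply/pred0P=> x; apply/negbTE; move: (in_sub x bAB) (dis x).
  by rewrite /=; bool_cases x.
rewrite -minor_dim cardsU disjoint_setI0 // cards0 subn0 eqn_add2r /=.
congr (_ && _); apply/col_spanningP/col_spanningP => Sb f fV f0.
  have [Zf|] := boolP (f \in Fsp F Z).
    apply/eqP; rewrite -memv0 -V1Z memv_contr fV //.
  case/negP; apply/memv_Fsp => e eZ.
  have fE : rst F (A :|: B) f + rst F Z f = f.
    apply/ffunP=> x; rewrite !(ffunE, lfunE) /=.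
    have [xY|xY] := boolP (x \in Y).
      rewrite f0 ?inE ?xY ?orbT //.
      by move: xY (dis x); bool_cases x; rewrite ?addr0.
    have [xAX|xAX] := boolP (x \in A :|: X).
      move: xY xAX (dis x); rewrite defX; bool_cases x => //=; rewrite ?addr0 ?add0r //.
    rewrite (Fsp_out (subvP sV1 _ fV) xAX).
    by do 2!case: ifP => _; rewrite ?addr0.
  have r0 : rst F (A :|: B) f = 0.
    apply: Sb => [|x xb].
      apply/memv_minor; split; first exact: rst_Fsp.
      by exists (rst F Z f); rewrite ?rst_Fsp // fE.
    rewrite lfunE ffunE f0 ?if_same //; by rewrite inE xb.
  by rewrite -fE r0 add0r lfunE ffunE (negPf eZ).
have /memv_minor[fAB [z zZ fzV]] := fV.
have fz0 : f + z = 0.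
  apply: Sb => // e; rewrite inE ffunE => /orP[eb|eY].
    rewrite f0 // (Fsp_out zZ) ?addr0 //.
    by move: eb (in_sub e bAB) (dis e); bool_cases e.
  rewrite (Fsp_out fAB) ?(Fsp_out zZ) ?addr0 //.
    by move: eY (dis e); bool_cases e.
  by move: eY (dis e); bool_cases e.
apply/ffunP=> e; rewrite ffunE; have [eAB|eAB] := boolP (e \in A :|: B).
  have /ffunP/(_ e) := fz0; rewrite !ffunE (Fsp_out zZ) ?addr0 //.
  by move: eAB (dis e); bool_cases e.
exact: Fsp_out fAB eAB.
Qed.

Lemma minor_coindep : exists2 b, b \in bases (vmat (A :|: X) V1) & [disjoint b & Z].
Proof.
have S : col_spanning V1 (A :|: X :\: Z).
  apply/col_spanningP => f fV f0; apply/eqP; rewrite -memv0 -V1Z memv_contr fV.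
  apply/memv_Fsp => e eZ; have [eAX|eAX] := boolP (e \in A :|: X).
    by apply: f0; move: eAX eZ; bool_cases e.
  exact: Fsp_out (subvP sV1 _ fV) eAX.
have [b [_ bS Vb Sb]] := exists_col_base (col_indep0 _) S (sub0set _).
exists b.
  rewrite inE; apply/(column_baseP _ sV1); split=> //.
  by apply: subset_trans bS _; rewrite setUS // subsetDl.
apply/pred0P=> x; apply/negbTE; move: (in_sub x bS) (dis x).
by rewrite /=; bool_cases x.
Qed.

Lemma minor_indep : indep (vmat (A :|: X) V1) Y.
Proof.
have [|||b [Yb bX Vb Sb]] := @exists_col_base _ _ V1 Y (A :|: X).
- by rewrite /col_indep V1Y.
- exact: spanning_Fsp.
- by apply/subsetP=> x; rewrite defX; bool_cases x.
by apply/indepP; exists b => //; rewrite inE; apply/(column_baseP _ sV1).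
Qed.

Lemma memv_Fsp_add f : reflect (exists2 z, z \in Fsp F Z & exists2 h, h \in V2' & f = z + h)
  (f \in V2).
Proof. by rewrite defV2; apply: memv_addP. Qed.

Let sV2X : (V2 <= Fsp F X)%VS.
Proof.
rewrite defV2 subv_add (subv_trans sV2) ?subv_Fsp //; apply/subsetP=> x;
by rewrite defX; bool_cases x.
Qed.

Lemma Fsp_add_column_base c : c \in bases (vmat X V2) <->
  exists2 b, b \in bases (vmat B V2') & c = Z :|: b.
Proof.
rewrite inE; split=> [/(column_baseP _ sV2X)[cX /col_indepP Vc /col_spanningP Sc] | [b]].
  exists (c :&: B).
    rewrite inE; apply/(column_baseP _ sV2); split; first exact: subsetIr.
      apply/col_indepP => g; have [f /memv_Fsp_add[z zZ [h hV ->]] fg] := Vc g.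
      exists h => // e /setIP[ec eB]; rewrite -fg // ffunE (Fsp_out zZ) ?add0r //.
      by move: eB (dis e); bool_cases e.
    apply/col_spanningP => f fV f0; apply: Sc.
      by apply/memv_Fsp_add; exists 0; rewrite ?mem0v //; exists f; rewrite ?add0r.
    move=> e ec; have [eB|eB] := boolP (e \in B); last exact: Fsp_out (subvP sV2 _ fV) eB.
    by apply: f0; rewrite inE ec.
  have Zc : Z \subset c.
    apply/subsetP=> e eZ; apply/negPn/negP => ec.
    have /ffunP/(_ e) : ([ffun x => (x == e)%:R] : vec F T) = 0.
      apply: Sc => [|x xc].
        apply/memv_Fsp_add; exists [ffun x => (x == e)%:R].
          apply/memv_Fsp => x xZ; rewrite ffunE; case: eqP => // xe.
          by rewrite xe eZ in xZ.
        by exists 0; rewrite ?mem0v // addr0.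
      by rewrite ffunE; case: eqP => // xe; rewrite -xe xc in ec.
    by rewrite !ffunE eqxx => /eqP; rewrite oner_eq0.
  have cY : [disjoint c & Y].
    apply/pred0Pn=> -[e /andP[/= ec eY]].
    have [f /memv_Fsp_add[z zZ [h hV ->]] /(_ e ec)] := Vc [ffun=> 1].
    rewrite !ffunE (Fsp_out zZ) ?(Fsp_out (subvP sV2 _ hV)) ?addr0.
    - by move/eqP; rewrite eq_sym oner_eq0.
    - by move: eY (dis e); bool_cases e.
    by move: eY (dis e); bool_cases e.
  apply/setP=> x; move: (in_sub x Zc) (in_sub x cX) (in_disj x cY).
  by rewrite defX; bool_cases x.
rewrite inE => /(column_baseP _ sV2)[bB /col_indepP Vb /col_spanningP Sb] ->.
apply/(column_baseP _ sV2X); split.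
- by apply/subsetP=> x; move: (in_sub x bB); rewrite defX; bool_cases x.
- apply/col_indepP => g; have [h hV hg] := Vb g.
  exists (rst F Z g + h).
    by apply/memv_Fsp_add; exists (rst F Z g); rewrite ?rst_Fsp //; exists h.
  move=> e; rewrite inE ffunE => /orP[eZ|eb].
    rewrite rst_in // (Fsp_out (subvP sV2 _ hV)) ?addr0 //.
    by move: eZ (dis e); bool_cases e.
  rewrite hg // (Fsp_out (rst_Fsp _ _)) ?add0r //.
  by move: eb (in_sub e bB) (dis e); bool_cases e.
apply/col_spanningP => f /memv_Fsp_add[z zZ [h hV ->]] f0.
have h0 : h = 0.
  apply: Sb => // e eb; have := f0 e; rewrite inE eb orbT ffunE => /(_ isT).
  rewrite (Fsp_out zZ) ?add0r //.
  by move: eb (in_sub e bB) (dis e); bool_cases e.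
rewrite h0 addr0; apply/ffunP=> e; rewrite ffunE.
have [eZ|/(Fsp_out zZ) //] := boolP (e \in Z).
by have := f0 e; rewrite inE eZ ffunE h0 ffunE addr0 => /(_ isT).
Qed.

Lemma minor_link : link A X V1 V2 = link A B V1' V2'.
Proof.
have dAB : [disjoint A & B].
  by apply/pred0P=> x; apply/negbTE; move: (dis x); rewrite /=; bool_cases x.
apply/vspaceP => f.
apply/(memv_link _ dAX sV1 sV2X)/(memv_link _ dAB minor_sub sV2) => -[fA].
  case=> _ /memv_Fsp_add[z zZ [h hV ->]] fV; split=> //; exists h => //.
  apply/memv_minor; split; last by exists z => //; rewrite -addrA [h + z]addrC.
  apply: memvD; first exact: subvP (subv_Fsp _ (subsetUl A B)) _ fA.
  exact: subvP (subv_trans sV2 (subv_Fsp _ (subsetUr A B))) _ hV.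
case=> h hV /memv_minor[_ [z zZ fV]]; split=> //; exists (z + h).
  by apply/memv_Fsp_add; exists z => //; exists h.
by rewrite [z + h]addrC addrA.
Qed.

(** Vectors on [Z] come for free from [V2].  Values on [Y] are attained by
    [V1] since [restr V1 Y] is full; once they are subtracted, what remains
    is a vector of [V1] vanishing on [Y], hence one of [V1']. *)
Lemma minor_rigid : rigid X V1 V2 <-> rigid B V1' V2'.
Proof.
apply: (iff_trans (rigidP _ sV2X)); apply: iff_trans (iff_sym (rigidP _ sV2)).
split=> -[/col_indepP iX c0]; split.
- apply/col_indepP=> g.
  have [_ /memv_addP[v vV [_ /memv_Fsp_add[z zZ [h hV ->]] ->]] fg] :=
    iX (rst F B g).
  (* As rst B g vanishes on Y and so do z and h, v vanishes on Y. *)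
  exists (rst F (A :|: B) v + h).
    apply: memv_add => //; apply/memv_minor; split; first exact: rst_Fsp.
    exists (rst F Z v); first exact: rst_Fsp.
    suff -> : rst F (A :|: B) v + rst F Z v = v by [].
    apply/ffunP=> e; rewrite !(ffunE, lfunE) /=.
    have [eAX|eAX] := boolP (e \in A :|: X); last first.
      rewrite (Fsp_out (subvP sV1 _ vV) eAX).
      by do 2!case: ifP => _; rewrite ?addr0.
    have [eY|eY] := boolP (e \in Y); last first.
      by move: eY eAX (dis e); rewrite defX; bool_cases e => //=; rewrite ?addr0 ?add0r.
    have eX : e \in X by rewrite defX !inE eY !orbT.
    have := fg e eX; rewrite (Fsp_out (rst_Fsp _ _)).
      rewrite !ffunE (Fsp_out zZ) ?(Fsp_out (subvP sV2 _ hV)) ?addr0.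
      - by move=> ->; rewrite !if_same addr0.
      - by move: eY (dis e); bool_cases e.
      by move: eY (dis e); bool_cases e.
    by move: eY (dis e); bool_cases e.
  move=> e eB; have eX : e \in X by rewrite defX !inE eB !orbT.
  have := fg e eX; rewrite rst_in // => <-; rewrite !ffunE rst_in ?inE ?eB ?orbT //.
  rewrite (Fsp_out zZ) ?add0r //.
  by move: eB (dis e); bool_cases e.
- apply/eqP; rewrite -subv0; apply/subvP=> f /memv_capP[/memv_minor[fAB [z zZ fzV]] fV].
  have : f + z \in (V1 :&: V2)%VS.
    by rewrite memv_cap fzV; apply/memv_Fsp_add; exists z => //; exists f; rewrite // addrC.
  rewrite c0 !memv0 => /eqP fz0; apply/eqP/ffunP=> e; rewrite ffunE.
  have [eAB|/(Fsp_out fAB) //] := boolP (e \in A :|: B).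
  have /ffunP/(_ e) := fz0; rewrite !ffunE (Fsp_out zZ) ?addr0 //.
  by move: eAB (dis e); bool_cases e.
- apply/col_indepP=> g.
  have /col_indepP/(_ g)[v0 v0V v0g] : col_indep V1 Y by rewrite /col_indep V1Y.
  have [_ /memv_addP[v vV [h hV ->]] vg] := iX (g - v0).
  have /memv_minor[vAB [z zZ vzV]] := vV.
  (* v0 takes care of Y, v + z and h of B, and the last vector on Z corrects Z. *)
  exists (v0 + (v + z) + (rst F Z (g - v0 - z) + h)).
    apply: memv_add; first exact: memvD.
    by apply/memv_Fsp_add; exists (rst F Z (g - v0 - z)); [exact: rst_Fsp | exists h].
  have hB := subvP sV2 _ hV.
  move=> e; rewrite [in X in X -> _]defX !inE => /orP[/orP[eZ|eY]|eB].
  + rewrite !ffunE rst_in // !ffunE (Fsp_out hB) ?(Fsp_out vAB).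
    * by rewrite add0r addr0 -[g e - _ - _]addrA -opprD addrC addNKr.
    * by move: eZ (dis e); bool_cases e.
    by move: eZ (dis e); bool_cases e.
  + rewrite !ffunE (Fsp_out hB) ?(Fsp_out vAB) ?(Fsp_out zZ) ?(Fsp_out (rst_Fsp _ _)).
    * by rewrite !addr0 v0g.
    * by move: eY (dis e); bool_cases e.
    * by move: eY (dis e); bool_cases e.
    * by move: eY (dis e); bool_cases e.
    by move: eY (dis e); bool_cases e.
  rewrite !ffunE (Fsp_out zZ) ?(Fsp_out (rst_Fsp _ _)).
  + have := vg e eB; rewrite !ffunE addr0 add0r -addrA => ->.
    by rewrite addrC subrK.
  + by move: eB (dis e); bool_cases e.
  by move: eB (dis e); bool_cases e.
apply/eqP; rewrite -subv0; apply/subvP=> f /memv_capP[fV /memv_Fsp_add[z zZ [h hV fE]]].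
have h0 : h = 0.
  apply/eqP; rewrite -memv0 -c0 memv_cap hV andbT; apply/memv_minor; split.
    exact: subvP (subv_trans sV2 (subv_Fsp _ (subsetUr _ _))) _ hV.
  by exists z; rewrite // addrC -fE.
by rewrite -V1Z memv_contr fV fE h0 addr0.
Qed.

Let sVB : forall b, b \in bases (vmat B V2') -> b \subset B.
Proof. by have [] := vmatP B V2'. Qed.

Let basesAB b : (b \in bases (vmat (A :|: B) V1')) =
  (b \subset A :|: B) && (b :|: Y \in bases (vmat (A :|: X) V1)).
Proof. by rewrite !inE minor_column_base. Qed.

Lemma minor_mrigid :
  mrigid X (vmat (A :|: X) V1) (vmat X V2) <->
  mrigid B (vmat (A :|: B) V1') (vmat B V2').
Proof.
exact: (reduced_mrigid (M := vmat (A :|: X) V1)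
  (MB := vmat (A :|: B) V1') dAX dZY dZB dYB defX (vmatP _ _) erefl erefl sVB basesAB
  Fsp_add_column_base minor_coindep minor_indep).
Qed.

Lemma minor_mlink :
  mlink A (vmat (A :|: X) V1) (vmat X V2) =
  mlink A (vmat (A :|: B) V1') (vmat B V2').
Proof.
exact: (reduced_mlink (M := vmat (A :|: X) V1)
  (MB := vmat (A :|: B) V1') dAX dZY dZB dYB defX (vmatP _ _) (vmatP _ _) erefl erefl
  sVB basesAB Fsp_add_column_base minor_coindep minor_indep).
Qed.

Lemma minor_covering b1 b2 :
  disjoint_covering_bases X (vmat (A :|: X) V1) (vmat X V2) b1 b2 ->
  disjoint_covering_bases B (vmat (A :|: B) V1') (vmat B V2')
    (b1 :\: Y) (b2 :\: Z).
Proof.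
exact: (covering_reduce (M := vmat (A :|: X) V1)
  (MB := vmat (A :|: B) V1') dAX dZY dZB dYB defX (vmatP _ _) erefl sVB basesAB
  Fsp_add_column_base).
Qed.

Lemma major_covering b1 b2 :
  disjoint_covering_bases B (vmat (A :|: B) V1') (vmat B V2') b1 b2 ->
  disjoint_covering_bases X (vmat (A :|: X) V1) (vmat X V2)
    (b1 :|: Y) (Z :|: b2).
Proof.
exact: (covering_extend dAX dZY dZB dYB defX sVB basesAB Fsp_add_column_base).
Qed.

End Minor.

Unset Implicit Arguments.

Theorem theorem72 (F : fieldType) (T : finType) (A X Z Y B : {set T})
    (V1AX V2X V1AB V2B : {vspace vec F T})
    (dAX : [disjoint A & X])
    (dZY : [disjoint Z & Y]) (dZB : [disjoint Z & B]) (dYB : [disjoint Y & B])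
    (defX : X = Z :|: Y :|: B)
    (sV1AX : (V1AX <= Fsp F (A :|: X))%VS)
    (sV2X : (V2X <= Fsp F X)%VS)
    (sV2B : (V2B <= Fsp F B)%VS)
    (defV1AB : V1AB = contr (restr V1AX (A :|: (X :\: Z))) (A :|: B))
    (defV2X : V2X = (Fsp F Z + 0 + V2B)%VS)
    (V1Z : contr V1AX Z = 0%VS)
    (V1Y : restr V1AX Y = Fsp F Y) :
  [/\ rigid X V1AX V2X <-> rigid B V1AB V2B,
      mrigid X (vmat (A :|: X) V1AX) (vmat X V2X) <->
        mrigid B (vmat (A :|: B) V1AB) (vmat B V2B),
      link A X V1AX V2X = link A B V1AB V2B
    & mlink A (vmat (A :|: X) V1AX) (vmat X V2X) =
        mlink A (vmat (A :|: B) V1AB) (vmat B V2B)]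
  /\
  (vmat (A :|: B) (V1AB + V2B)%VS =
     munion_ext A (vmat (A :|: B) V1AB) (vmat B V2B) ->
   vmat (A :|: B) (perp (A :|: B) V1AB + perp B V2B)%VS =
     munion_ext A (vmat (A :|: B) (perp (A :|: B) V1AB))
                  (vmat B (perp B V2B)) ->
   [/\ [/\ vmat A (link A X V1AX V2X) =
             mlink A (vmat (A :|: X) V1AX) (vmat X V2X),
           mlink A (vmat (A :|: X) V1AX) (vmat X V2X) =
             mlink A (vmat (A :|: B) V1AB) (vmat B V2B)
         & mlink A (vmat (A :|: B) V1AB) (vmat B V2B) =
             vmat A (link A B V1AB V2B)],
       rigid X V1AX V2X <->
         mrigid X (vmat (A :|: X) V1AX) (vmat X V2X)
     & [/\ rigid B V1AB V2B <->
             (exists b1 b2 : {set T}, disjoint_covering_bases B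
                (vmat (A :|: B) V1AB) (vmat B V2B) b1 b2),
           rigid X V1AX V2X <->
             (exists b1 b2 : {set T}, disjoint_covering_bases X
                (vmat (A :|: X) V1AX) (vmat X V2X) b1 b2),
           forall b1 b2 : {set T},
             disjoint_covering_bases B
               (vmat (A :|: B) V1AB) (vmat B V2B) b1 b2 ->
             column_base A (link A X V1AX V2X) (b1 :&: A)
         & forall b1 b2 : {set T},
             disjoint_covering_bases X
               (vmat (A :|: X) V1AX) (vmat X V2X) b1 b2 ->
             column_base A (link A X V1AX V2X) (b1 :&: A)]]).
Proof.
have dAB : [disjoint A & B].
  by rewrite defX in dAX; apply: disjointWr dAX; apply: subsetUr.
have {}defV2X : V2X = (Fsp F Z + V2B)%VS by rewrite defV2X addv0.
have sV1AB : (V1AB <= Fsp F (A :|: B))%VS := minor_sub defV1AB.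
have rigidXB := minor_rigid dAX dZY dZB dYB defX sV1AX sV2B defV1AB defV2X V1Z V1Y.
have mrigidXB :=
  minor_mrigid dAX dZY dZB dYB defX sV1AX sV2B defV1AB defV2X V1Z V1Y.
have linkXB := minor_link dAX dZY dZB dYB defX sV1AX sV2B defV1AB defV2X.
have mlinkXB :=
  minor_mlink dAX dZY dZB dYB defX sV1AX sV2B defV1AB defV2X V1Z V1Y.
have coverXB :=
  minor_covering dAX dZY dZB dYB defX sV1AX sV2B defV1AB defV2X V1Z V1Y.
have coverBX :=
  major_covering dAX dZY dZB dYB defX sV1AX sV2B defV1AB defV2X V1Z V1Y.
split; first exact: And4 rigidXB mrigidXB linkXB mlinkXB.
move=> vmatD _.
have vlink := vmat_link dAB sV1AB sV2B vmatD.
have covB := rigid_covering sV1AB sV2B vmatD.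
have mrB := mrigid_rigid sV1AB sV2B vmatD.
have baseB := covering_link_base dAB sV1AB sV2B vmatD.
have rmB : rigid B V1AB V2B <-> mrigid B (vmat (A :|: B) V1AB) (vmat B V2B).
  by split=> [/covB[b1 [b2]]|]; [apply: covering_mrigid | apply: mrB].
have rcB : rigid B V1AB V2B <-> exists b1 b2, disjoint_covering_bases B
    (vmat (A :|: B) V1AB) (vmat B V2B) b1 b2.
  by split=> [|[b1 [b2 /covering_mrigid]]]; [exact: covB | exact: mrB].
split.
- apply: And3 (mlinkXB) (esym vlink).
  exact: etrans (congr1 (vmat A) linkXB) (etrans vlink (esym mlinkXB)).
- by split=> [/rigidXB/rmB/mrigidXB | /mrigidXB/rmB/rigidXB].
split; first exact: rcB.
- split=> [/rigidXB/rcB[b1 [b2 cov]]|[b1 [b2 cov]]].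
    by exists (b1 :|: Y), (Z :|: b2); apply: coverBX.
  apply/rigidXB/rcB.
  by exists (b1 :\: Y), (b2 :\: Z); apply: coverXB.
- by move=> b1 b2 cov; rewrite linkXB; exact: baseB cov.
move=> b1 b2 cov; rewrite linkXB.
have <- : (b1 :\: Y) :&: A = b1 :&: A.
  apply/setP=> x; move: (parts_disjoint dAX dZY dZB dYB defX x).
  by bool_cases x.
exact: baseB (coverXB _ _ cov).
Qed.
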